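(* Let $0<R_1<R_0<R_2$, and let $\Gamma_{R_0}$ be a closed subset of $\mathbb{S}_{R_0}$ with $\Gamma_{R_0}\neq\mathbb{S}_{R_0}$. Let $\Phi=\Phi_0^{R_0,R_2}[\mathbf{m}]+\Phi_1^{R_1,R_2}[h]$ on $\mathbb{S}_{R_2}$ for some $\mathbf{m}\in L^2(\Gamma_{R_0},\mathbb{R}^3)$ and some $h\in L^2(\mathbb{S}_{R_1})$. Then a pair of potentials of the form $\bar\Phi_0=\Phi_0^{R_0,R_2}[\bar{\mathbf{m}}]$ and $\bar\Phi_1=\Phi_1^{R_1,R_2}[\bar h]$, with $\bar{\mathbf{m}}\in L^2(\Gamma_{R_0},\mathbb{R}^3)$ and $\bar h\in L^2(\mathbb{S}_{R_1})$, is uniquely determined by the condition $\Phi(x)=\bar\Phi_0(x)+\bar\Phi_1(x)$, $x\in\mathbb{S}_{R_2}$. (That is, any two such pairs $(\bar\Phi_0,\bar\Phi_1)$ satisfying this condition coincide.)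
   Context: $\mathbb{S}_R=\{x\in\mathbb{R}^3:|x|=R\}$, with surface measure $\omega_R$. For $\mathbf{m}\in L^2(\Gamma_{R_0},\mathbb{R}^3)$ and $h\in L^2(\mathbb{S}_{R_1})$, define for $x\in\mathbb{S}_{R_2}$ $$\Phi_0^{R_0,R_2}[\mathbf{m}](x)=\frac{1}{4\pi}\int_{\Gamma_{R_0}}\mathbf{m}(y)\cdot\frac{x-y}{|x-y|^3}\,d\omega_{R_0}(y),\qquad \Phi_1^{R_1,R_2}[h](x)=\frac{1}{4\pi R_1}\int_{\mathbb{S}_{R_1}}h(y)\frac{|x|^2-R_1^2}{|x-y|^3}\,d\omega_{R_1}(y).$$ *)

(* Defs.v *)
From HB Require Import structures.
From mathcomp Require Import all_boot all_order all_algebra.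
From mathcomp Require Import all_classical all_reals all_analysis.
From mathcomp Require Import measurable_realfun.

Set Implicit Arguments.
Unset Strict Implicit.
Unset Printing Implicit Defensive.
Import Order.TTheory GRing.Theory Num.Theory.
Import numFieldNormedType.Exports.
Local Open Scope classical_set_scope.
Local Open Scope ring_scope.

(* Borel sigma-algebra on 'M[R]_(m, n), in particular on R^3 = 'rV[R]_3. *)
HB.instance Definition _ (R : realType) (m n : nat) :=
  @isMeasurable.Build (sigma_display (@open 'M[R]_(m, n))) 'M[R]_(m, n)
    <<s @open 'M[R]_(m, n) >>
    (@sigma_algebra0 _ setT (@open 'M[R]_(m, n)))
    (@sigma_algebraC _ (@open 'M[R]_(m, n)))
    (@sigma_algebra_bigcup _ setT (@open 'M[R]_(m, n))).

Section borel_matrix.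
Variables (R : realType) (m n : nat).

Lemma open_mx_bigcup (U : set 'M[R]_(m, n)) : open U ->
  U = \bigcup_(p in [set p : 'M[rat]_(m, n) * nat |
        ball (map_mx (@ratr R) p.1) p.2.+1%:R^-1 `<=` U])
      ball (map_mx (@ratr R) p.1) p.2.+1%:R^-1.
Proof.
move=> oU; apply/seteqP; split=> [x Ux|x [p /= pU] /pU //].
have /nbhs_ballP[e /= e0 xeU] : nbhs x U by exact: open_nbhs_nbhs.
have e20 : 0 < e / 2 by rewrite divr_gt0.
have [k _ kP] := near_infty_natSinv_lt (PosNum e20).
have {kP} /= kP := kP k (leqnn k).
have {}kP : k.+1%:R^-1 + k.+1%:R^-1 < e by rewrite [ltRHS](splitr e) ltrD.
have k0 : (0 : R) < k.+1%:R^-1 by rewrite invr_gt0.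
have rq i j : exists q : rat, ball (x i j) k.+1%:R^-1 (ratr q).
  have /rat_in_itvoo[q] : x i j - k.+1%:R^-1 < x i j + k.+1%:R^-1.
    by rewrite ltrBlDr -addrA ltrDl addr_gt0.
  by rewrite in_itv/= => qP; exists q; rewrite /ball/= ltr_distlC.
pose q := \matrix_(i, j) sval (cid (rq i j)).
have xq : ball x k.+1%:R^-1 (map_mx (@ratr R) q).
  by split=> // i j; rewrite !mxE; exact: (svalP (cid (rq i j))).
exists (q, k) => /=; last exact: ball_sym.
move=> y qy; apply: xeU; apply: (le_ball (ltW kP)).
exact: ball_triangle xq qy.
Qed.

Lemma measurable_fun_mx d (T : measurableType d) (D : set T)
    (f : T -> 'M[R]_(m, n)) :
  (forall i j, measurable_fun D (fun t => f t i j)) -> measurable_fun D f.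
Proof.
move=> mf mD; apply: (measurability (@open 'M[R]_(m, n))) => // _ [U oU <-].
rewrite (open_mx_bigcup oU) preimage_bigcup setI_bigcupr bigcup_mkcond.
apply: countable_bigcupT_measurable => [|p]; first exact: countableP.
case: ifP => // _.
rewrite [X in measurable X](_ : _ = D `&` \bigcap_(ij in [set: 'I_m * 'I_n])
   (D `&` (fun t => f t ij.1 ij.2) @^-1`
      ball (map_mx (@ratr R) p.1 ij.1 ij.2) p.2.+1%:R^-1)).
  apply: measurableI => //; apply: fin_bigcap_measurable => // ij _.
  apply: mf => //.
  by apply: open_measurable; exact: ball_open.
apply/seteqP; split=> [t [Dt [_ ft]]|t [Dt ft]]; split=> //.
  by move=> [i j] _; split=> //=; exact: ft.
by split; [rewrite invr_gt0|move=> i j; have [] := ft (i, j) I].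
Qed.

End borel_matrix.

Section potentials.
Variable R : realType.
Implicit Types (x y : 'rV[R]_3) (r : R).

Definition dot x y : R := \sum_(i < 3) x 0 i * y 0 i.

(* The Euclidean norm; the library norm `|x| on 'rV[R]_3 is the sup norm. *)
Definition enorm x : R := Num.sqrt (dot x x).

Definition esphere r : set 'rV[R]_3 := [set x | enorm x = r].

(* Spherical coordinates: p = (theta, phi), theta being the polar angle. *)
Definition sphere_param r (p : measurableTypeR R * measurableTypeR R)
    : 'rV[R]_3 :=
  \row_(i < 3) [:: r * sin p.1 * cos p.2; r * sin p.1 * sin p.2;
                   r * cos p.1]`_i.

Definition sphere_dom : set (measurableTypeR R * measurableTypeR R) :=
  `[0, pi] `*` `[0, 2 * pi].

(* The surface measure of the sphere of radius r, as a Borel measure on R^3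
   carried by it: the area element is r^2 sin(theta) dtheta dphi. *)
Definition sphere_measure r : set 'rV[R]_3 -> \bar R := fun A =>
  (\int[lebesgue_measure \x lebesgue_measure]_(p in
      sphere_dom `&` sphere_param r @^-1` A) (r ^+ 2 * sin p.1)%:E)%E.

Section sphere_measure_isMeasure.
Variable r : R.

Lemma measurable_sphere_param : measurable_fun setT (sphere_param r).
Proof.
have m1 (f : R -> R) : measurable_fun setT f ->
    measurable_fun setT (fun p : measurableTypeR R * measurableTypeR R => f p.1).
  by move=> mf; exact: (measurableT_comp mf measurable_fst).
have m2 (f : R -> R) : measurable_fun setT f ->
    measurable_fun setT (fun p : measurableTypeR R * measurableTypeR R => f p.2).
  by move=> mf; exact: (measurableT_comp mf measurable_snd).
have ms : measurable_fun setT (@sin R).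
  by apply: continuous_measurable_fun; exact: continuous_sin.
have mc : measurable_fun setT (@cos R).
  by apply: continuous_measurable_fun; exact: continuous_cos.
apply: measurable_fun_mx => i [[|[|[|//]]] jlt];
  under eq_fun do rewrite mxE/=;
  by repeat (apply: measurable_funM => //); auto.
Qed.

Lemma measurable_sphere_dom : measurable sphere_dom.
Proof. exact: measurableX. Qed.

Lemma measurable_sphere_density (D : set _) : measurable D ->
  measurable_fun D (fun p : measurableTypeR R * measurableTypeR R =>
    (r ^+ 2 * sin p.1)%:E).
Proof.
move=> mD; apply: measurable_funTS; apply/measurable_EFinP.
apply: measurable_funM => //.
apply: (measurableT_comp _ measurable_fst).
by apply: continuous_measurable_fun; exact: continuous_sin.
Qed.

Lemma sphere_density_ge0 p : sphere_dom p -> (0 <= (r ^+ 2 * sin p.1)%:E)%E.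
Proof.
case=> /=; rewrite in_itv/= => p1 _.
by rewrite lee_fin mulr_ge0 ?sqr_ge0// sin_ge0_pi.
Qed.

Let sphere_measure0 : sphere_measure r set0 = 0%E.
Proof. by rewrite /sphere_measure preimage_set0 setI0 integral_set0. Qed.

Let sphere_measure_ge0 A : (0 <= sphere_measure r A)%E.
Proof. by apply: integral_ge0 => p [/sphere_density_ge0]. Qed.

Let sphere_measure_sigma_additive : semi_sigma_additive (sphere_measure r).
Proof.
move=> A mA tA mUA.
have mF k : measurable (sphere_dom `&` sphere_param r @^-1` A k).
  apply: measurableI; first exact: measurable_sphere_dom.
  by rewrite -[X in measurable X]setTI; exact: measurable_sphere_param.
rewrite /sphere_measure preimage_bigcup setI_bigcupr ge0_integral_bigcup//=.
- apply: is_cvg_ereal_nneg_natsum_cond => n _ _.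
  exact: sphere_measure_ge0.
- by apply: measurable_sphere_density; exact: bigcupT_measurable.
- by move=> p [k _ [/sphere_density_ge0]].
- move=> i j _ _ [p [[_ ip] [_ jp]]]; apply: tA => //.
  by exists (sphere_param r p).
Qed.

HB.instance Definition _ := isMeasure.Build _ _ _ (sphere_measure r)
  sphere_measure0 sphere_measure_ge0 sphere_measure_sigma_additive.

End sphere_measure_isMeasure.

(* L^2(G), for a Borel subset G of the sphere of radius r: the functions whose
   extension by 0 is square integrable for the surface measure.  The values
   outside G are irrelevant. *)
Definition L2 r (G : set 'rV[R]_3) (h : 'rV[R]_3 -> R) : Prop :=
  h \_ G \in Lfun (sphere_measure r) 2%:E.

Definition L2_vec r (G : set 'rV[R]_3) (m : 'rV[R]_3 -> 'rV[R]_3) : Prop :=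
  forall i, L2 r G (fun y => m y 0 i).

Definition Phi0 R0 (G : set 'rV[R]_3) (m : 'rV[R]_3 -> 'rV[R]_3) x : R :=
  (4 * pi)^-1 * \int[sphere_measure R0]_(y in G)
    (dot (m y) (x - y) / enorm (x - y) ^+ 3).

Definition Phi1 R1 (h : 'rV[R]_3 -> R) x : R :=
  (4 * pi * R1)^-1 * \int[sphere_measure R1]_(y in esphere R1)
    (h y * ((enorm x ^+ 2 - R1 ^+ 2) / enorm (x - y) ^+ 3)).

End potentials.

(* Main.v *)
(* By linearity it suffices to show that u0 = Phi0[m] and u1 = Phi1[h] vanish on
   the sphere of radius R2 as soon as u0 + u1 does.  Both are harmonic off the
   supports of their densities and tend to 0 at infinity.  The maximum principle
   gives u0 + u1 = 0 for |x| >= R2; since Gamma misses a piece of the sphere of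
   radius R0, analytic continuation along a ray through this gap and then around
   the sphere of radius s = (R0 + R1) / 2 gives u0 + u1 = 0 near |x| = s.  Hence
   u0 on |x| <= s and - u1 on |x| >= s glue to a harmonic function on R^3 that
   tends to 0 at infinity, so it is 0.

   Analyticity is used along lines only and in the quantitative form of Taylor
   remainders bounded by C (|t| / r)^N, which passes through the integrals and
   needs neither differentiation under the integral nor convergent series. *)
Require Import Defs.
From mathcomp Require Import all_boot all_order all_algebra.
From mathcomp Require Import all_classical all_reals all_analysis.
From mathcomp Require Import measurable_realfun ring lra.
Import Order.TTheory GRing.Theory Num.Theory.
Import numFieldNormedType.Exports.
Local Open Scope classical_set_scope.
Local Open Scope ring_scope.

Set Implicit Arguments.
Unset Strict Implicit.
Unset Printing Implicit Defensive.

(** * Quantitative analyticity in one variable *)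

(** The gap in [Gamma] is what makes separation possible: dipoles on a full sphere can reproduce,
    outside it, the field of suitable sources on the inner sphere, and every path into the shell
    between the two spheres would meet singularities. Continuation in finitely many steps needs a
    radius of analyticity bounded below along the path. A potential at distance at least [d] from
    its sources has radius [d / 8], so a lower bound on distances is all that a path has to provide.
    Along a line both kernels are polynomials in t times |x + t v - y|^-3, so one expansion serves
    both. Its constants [4 / d ^+ 3] and [d / 8] depend neither on the source point y nor on the
    direction v; this uniformity is what survives integration against the densities. The maximum
    principle is proved for functions that are harmonic only where they do not vanish. This admits a
    function extended by zero across a sphere on which it vanishes, as happens at radius [R2]. *)

Section power_approximation.
Context {R : realType}.
Implicit Types (f g : R -> R) (a b : nat -> R) (C D r e t k : R).

(* Quantitative real analyticity at 0: [a] is the Taylor sequence of [f] and the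
   N-th Taylor remainder is at most [C (|t| / r)^N] on [|t| <= r]. *)
Definition analytic0 f a (C r : R) := forall N t, `|t| <= r ->
  `|f t - \sum_(n < N) a n * t ^+ n| <= C * (`|t| / r) ^+ N.

Lemma analytic0_value f a C r : 0 < r -> analytic0 f a C r -> f 0 = a 0%N.
Proof.
move=> r0 /(_ 1%N 0); rewrite normr0 => /(_ (ltW r0)).
rewrite big_ord1 mul0r expr1 expr0 mulr1 mulr0 normr_le0 subr_eq0.
by move/eqP.
Qed.

Lemma analytic0_ge0 f a C r : 0 < r -> analytic0 f a C r -> 0 <= C.
Proof.
move=> r0 /(_ 0%N 0); rewrite normr0 expr0 mulr1 => /(_ (ltW r0)).
exact: le_trans.
Qed.

Lemma analytic0_bound f a C r t : analytic0 f a C r -> `|t| <= r -> `|f t| <= C.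
Proof. by move=> fa /(fa 0%N); rewrite big_ord0 subr0 expr0 mulr1. Qed.

Lemma analytic0_le f a C (C' : R) r (r' : R) : 0 < r' -> r' <= r -> C <= C' ->
  analytic0 f a C r -> analytic0 f a C' r'.
Proof.
move=> r'0 r'r CC' fa N t tr'; have r0 := lt_le_trans r'0 r'r.
apply: (le_trans (fa N t (le_trans tr' r'r))).
have C0 := analytic0_ge0 r0 fa.
apply: ler_pM => //; first by rewrite exprn_ge0// divr_ge0// ltW.
by rewrite lerXn2r ?nnegrE ?divr_ge0 ?(ltW r0) ?(ltW r'0)// ler_wpM2l// lef_pV2 ?posrE.
Qed.

Lemma analytic0D f g a b C D r : analytic0 f a C r -> analytic0 g b D r ->
  analytic0 (fun t => f t + g t) (fun n => a n + b n) (C + D) r.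
Proof.
move=> fa gb N t tr.
under eq_bigr do rewrite mulrDl.
rewrite big_split/= opprD addrACA mulrDl.
by rewrite (le_trans (ler_normD _ _))// lerD// ?fa ?gb.
Qed.

Lemma analytic0Z f a C r k : analytic0 f a C r ->
  analytic0 (fun t => k * f t) (fun n => k * a n) (`|k| * C) r.
Proof.
move=> fa N t tr.
under eq_bigr do rewrite -mulrA.
by rewrite -mulr_sumr -mulrBr normrM -mulrA ler_wpM2l// fa.
Qed.

Definition shift_seq a n := if n is n'.+1 then a n' else 0.

Lemma analytic0X f a C r : 0 < r -> analytic0 f a C r ->
  analytic0 (fun t => t * f t) (shift_seq a) (C * r) r.
Proof.
move=> r0 fa [|N] t tr.
  rewrite big_ord0 subr0 normrM expr0 mulr1 mulrC ler_pM//.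
  exact: (analytic0_bound fa tr).
rewrite big_ord_recl mul0r add0r.
under eq_bigr do rewrite lift0 /= exprS mulrCA.
rewrite -mulr_sumr -mulrBr normrM exprS mulrA -(mulrA C) (mulrCA r) divff ?gt_eqF//.
by rewrite mulr1 [C * _]mulrC -mulrA ler_wpM2l// fa.
Qed.

Lemma geometric_bound_le0 (x C q : R) : 0 <= q < 1 ->
  (forall N, x <= C * q ^+ N) -> x <= 0.
Proof.
move=> /andP[q0 q1] xC.
have h : (fun N => C * q ^+ N) @ \oo --> C * 0.
  by apply: cvgMr; apply: cvg_expr; rewrite ger0_norm.
rewrite mulr0 in h.
by apply: (cvgr_to_ge h); near=> N; apply: xC.
Unshelve. all: by end_near. Qed.

(** A Cauchy estimate: at [t = r] the remainders of orders n and n+1 are both at most [C], and they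
    differ by [a n * r ^+ n]. *)
Lemma analytic0_coef f a C r n : 0 < r -> analytic0 f a C r ->
  `|a n| <= 2 * C / r ^+ n.
Proof.
move=> r0 fa; rewrite ler_pdivlMr ?exprn_gt0//.
have := fa n.+1 r; have := fa n r.
rewrite gtr0_norm// divff ?gt_eqF// !expr1n mulr1 => /(_ (lexx _)) h1 /(_ (lexx _)).
rewrite big_ord_recr/= opprD addrA => h2.
rewrite -(ger0_norm (ltW (exprn_gt0 n r0))) -normrM.
set s := f r - _ in h1 h2.
have -> : a n * r ^+ n = s - (s - a n * r ^+ n) by ring.
by rewrite (le_trans (ler_normB _ _))// mulr2n mulrDl mul1r lerD.
Qed.

(** Once the lower coefficients vanish, the remainder of order n+1 at a small t > 0 reads |a n| t^n
    <= C (t / r)^(n+1), that is |a n| <= C t / r^(n+1), and t is arbitrarily small. *)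
Lemma analytic0_coef_eq0 f a C r e : 0 < r -> 0 < e -> analytic0 f a C r ->
  (forall t, `|t| < e -> f t = 0) -> forall n, a n = 0.
Proof.
move=> r0 e0 fa f0 n; have C0 := analytic0_ge0 r0 fa.
elim/ltn_ind: n => n IH; apply/eqP; rewrite -normr_le0.
apply/ler_addgt0Pr => d d0; rewrite add0r.
(* [C + 1] in place of [C] keeps [D] positive, so that [d / D] is a positive bound for [t]. *)
pose D := (C + 1) / r ^+ n.+1.
have D0 : 0 < D by rewrite divr_gt0 ?exprn_gt0// ltr_wpDl.
pose t := Num.min r (Num.min (e / 2) (d / D)).
have t0 : 0 < t by rewrite !lt_min r0 (divr_gt0 e0)//= (divr_gt0 d0 D0).
have tr : t <= r by rewrite ge_min lexx.
have te : t < e.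
  rewrite !gt_min; apply/orP; right; apply/orP; left.
  by rewrite ltr_pdivrMr// ltr_pMr// ltr1n.
have td : t <= d / D by rewrite !ge_min lexx !orbT.
have := fa n.+1 t; rewrite gtr0_norm// => /(_ tr).
have -> : f t = 0 by apply: f0; rewrite gtr0_norm.
rewrite big_ord_recr/= big1 => [|i _]; last by rewrite IH ?mul0r.
rewrite sub0r normrN add0r normrM (gtr0_norm (exprn_gt0 _ t0)) expr_div_n.
have -> : C * (t ^+ n.+1 / r ^+ n.+1) = C / r ^+ n.+1 * t * t ^+ n.
  by rewrite exprSr; ring.
rewrite ler_pM2r ?exprn_gt0// => /le_trans; apply.
have : D * t <= d by rewrite mulrC -ler_pdivlMr.
apply: le_trans; rewrite ler_wpM2r ?(ltW t0)//.
by rewrite ler_wpM2r ?invr_ge0 ?exprn_ge0 ?ltW// ltrDl.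
Qed.

(** The identity theorem: with all coefficients zero, |f t| <= C (|t| / r)^N for every N, and the
    ratio is below 1. *)
Lemma analytic0_flat f a C r e : 0 < r -> 0 < e -> analytic0 f a C r ->
  (forall t, `|t| < e -> f t = 0) -> forall t, `|t| < r -> f t = 0.
Proof.
move=> r0 e0 fa f0 t tr; apply/eqP; rewrite -normr_le0.
apply: (@geometric_bound_le0 _ C (`|t| / r)).
  by rewrite divr_ge0 ?(ltW r0)//= ltr_pdivrMr// mul1r.
move=> N; have := fa N t (ltW tr).
rewrite big1 ?subr0// => i _.
by rewrite (analytic0_coef_eq0 r0 e0 fa f0) mul0r.
Qed.

End power_approximation.

(** * The Taylor expansion of the inverse cube of a distance *)

Section inverse_cube_expansion.
Context {R : realType}.
Implicit Types (c q b d t : R).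

(* The Taylor coefficients of the solution of [(q + 2bt + t^2) g' = -3 (b + t) g]
   with [g 0 = c]. *)
Fixpoint cube_coef c q b n : R := if n is n1.+1 then
    - ((2 * n1%:R + 3) * b * cube_coef c q b n1 +
       (if n1 is n2.+1 then (n1%:R + 2) * cube_coef c q b n2 else 0))
    / (n1.+1%:R * q)
  else c.

Lemma cube_coefS c q b n : q != 0 ->
  n.+1%:R * q * cube_coef c q b n.+1 =
  - ((2 * n%:R + 3) * b * cube_coef c q b n +
     (if n is n2.+1 then (n%:R + 2) * cube_coef c q b n2 else 0)).
Proof. by move=> q0 /=; rewrite mulrC divfK// mulf_neq0// pnatr_eq0. Qed.

(** Induction on two consecutive coefficients. The rate [4 / d], coarser than [4 / rho], makes one
    bound serve all source points at distance at least [d]. *)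
Lemma cube_coef_le c rho b d n : 0 <= c -> 0 < d -> d <= rho -> `|b| <= rho ->
  `|cube_coef c (rho ^+ 2) b n| <= c * (4 / d) ^+ n.
Proof.
move=> c0 d0 drho brho; have rho0 := lt_le_trans d0 drho.
set l := 4 / d; have l0 : 0 < l by rewrite divr_gt0.
have rl : rho^-1 <= l / 4.
  by rewrite /l mulrAC divff// mul1r lef_pV2.
clearbody l; have r0 : 0 < rho^-1 by rewrite invr_gt0.
have step k X : 0 <= X -> `|cube_coef c (rho ^+ 2) b k| <= X * l ->
    `|if k is k2.+1 then (k%:R + 2) * cube_coef c (rho ^+ 2) b k2 else 0| <=
      (k%:R + 2) * X ->
    `|cube_coef c (rho ^+ 2) b k.+1| <= X * l ^+ 2.
  move=> X0 h1 h2; have k0 : 0 <= k%:R :> R by [].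
  have kk0 : 0 < k.+1%:R * rho ^+ 2 by rewrite mulr_gt0// exprn_gt0.
  rewrite /= normrM normrN normfV (gtr0_norm kk0).
  rewrite ler_pdivrMr//.
  apply: (le_trans (ler_normD _ _)).
  apply: (@le_trans _ _ ((2 * k%:R + 3) * rho * (X * l) + (k%:R + 2) * X)).
    apply: lerD => //; rewrite !normrM ger0_norm; last by lra.
    by rewrite ler_pM ?mulr_ge0// ler_wpM2l//; lra.
  have rhol : 4 <= rho * l.
    by rewrite mulrC -ler_pdivrMr// -ler_pdivlMl// mulrC.
  rewrite -[k.+1%:R]natr1.
  have e1 : X * l ^+ 2 * ((k%:R + 1) * rho ^+ 2) = X * ((k%:R + 1) * (rho * l) ^+ 2).
    by ring.
  rewrite e1 (_ : _ + _ = X * ((2 * k%:R + 3) * (rho * l) + (k%:R + 2))); last by ring.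
  (* With z = rho * l >= 4 the recurrence asks for (2k + 3) z + (k + 2) <= (k + 1) z^2. *)
  rewrite ler_wpM2l//; move: (rho * l) rhol => z z4.
  have h0 : 0 <= z * (z - 4) by rewrite mulr_ge0; lra.
  have h3 : 0 <= k%:R * (z * (z - 4)) by rewrite mulr_ge0.
  have h4 : 0 <= k%:R * (z - 4) by rewrite mulr_ge0//; lra.
  lra.
suff : `|cube_coef c (rho ^+ 2) b n| <= c * l ^+ n /\
       `|cube_coef c (rho ^+ 2) b n.+1| <= c * l ^+ n.+1 by case.
elim: n => [|n [IH1 IH2]].
  split; first by rewrite expr0 mulr1 /= ger0_norm.
  (* Here k = 0 and X = c / l; the coefficient of index -1 counts as 0. *)
  rewrite expr1 [leRHS](_ : _ = c / l * l ^+ 2); last first.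
    by rewrite expr2 mulrA divfK ?gt_eqF.
  apply: step; rewrite ?divfK ?gt_eqF//.
  - by rewrite divr_ge0// ltW.
  - by rewrite /= ger0_norm.
  - by rewrite normr0 mulr_ge0// ?divr_ge0 ?addr_ge0// ltW.
split=> //; have -> : l ^+ n.+2 = l ^+ n * l ^+ 2 by rewrite -exprD addn2.
  rewrite mulrA.
apply: step.
- by rewrite mulr_ge0// exprn_ge0// ltW.
- by rewrite -mulrA -exprSr.
- by rewrite normrM ger0_norm ?addr_ge0// ler_wpM2l ?addr_ge0.
Qed.

Lemma mean_value_at0 (h dh : R -> R) t :
  (forall s : R, `|s| <= `|t| -> is_derive s 1 h (dh s)) ->
  exists2 s : R, `|s| <= `|t| & h t - h 0 = dh s * t.
Proof.
move=> hd.
have hc (A : set R) : (forall s : R, A s -> `|s| <= `|t|) -> {within A, continuous h}.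
  move=> At; apply: continuous_in_subspaceT => s /set_mem/At st.
  by apply: differentiable_continuous; apply/derivable1_diffP; have [] := hd s st.
have [t0|t0] := leP 0 t.
  have [||s + E] := @MVT_segment R h dh 0 t t0.
  - move=> s; rewrite in_itv/= => /andP[s0 st]; apply: hd.
    by rewrite !ger0_norm// ltW.
  - apply: hc => s /=; rewrite in_itv/= => /andP[s0 st].
    by rewrite !ger0_norm.
  - rewrite in_itv/= => /andP[s0 st]; exists s; last by rewrite E subr0.
    by rewrite !ger0_norm.
have [||s + E] := @MVT_segment R h dh t 0 (ltW t0).
- move=> s; rewrite in_itv/= => /andP[st s0]; apply: hd.
  by rewrite !ltr0_norm// lerN2 ltW.
- apply: hc => s /=; rewrite in_itv/= => /andP[st s0].
  by rewrite !ler0_norm ?(ltW t0)// lerN2.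
- rewrite in_itv/= => /andP[st s0]; exists s.
    by rewrite !ler0_norm ?(ltW t0)// lerN2.
  by rewrite -opprB E sub0r mulrN opprK.
Qed.

Definition psum (a : nat -> R) N t := \sum_(n < N) a n * t ^+ n.
Definition dpsum (a : nat -> R) N t := \sum_(n < N) a n * (n%:R * t ^+ n.-1).

Lemma is_derive_psum a N t : is_derive t 1 (psum a N) (dpsum a N t).
Proof.
elim: N => [|N IH].
  rewrite /psum/dpsum.
  under eq_fun do rewrite big_ord0.
  by rewrite big_ord0; exact: is_derive_cst.
rewrite /psum/dpsum.
under eq_fun do rewrite big_ord_recr/=.
rewrite big_ord_recr/=; apply: is_deriveD.
apply: is_deriveZ.
have := @is_deriveX R R id N t 1 1 (is_derive_id _ _).
rewrite [_%:A]mulr1 (_ : id ^+ N = fun x : R => x ^+ N)//.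
by apply/funext => x; rewrite exprfctE.
Qed.

(** The recurrence cancels every power below t^N. At t^N the contribution of the missing coefficient
    N+1 is left over, and at t^(N+1) only the last coefficient contributes. *)
Lemma cube_coef_residual c q b N t : q != 0 ->
  (q + 2 * b * t + t ^+ 2) * dpsum (cube_coef c q b) N.+1 t +
    3 * (b + t) * psum (cube_coef c q b) N.+1 t =
  - (q * N.+1%:R * cube_coef c q b N.+1 * t ^+ N) +
    (N%:R + 3) * cube_coef c q b N * t ^+ N.+1.
Proof.
move=> q0; elim: N => [|N IH].
  have := @cube_coefS c q b 0 q0; rewrite /dpsum /psum !big_ord1.
  move: (cube_coef c q b 1) => c1 /= h.
  rewrite (_ : q * _ * c1 = 1%:R * q * c1); last by ring.
  by rewrite h; ring.
have := @cube_coefS c q b N.+1 q0.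
move: (cube_coef c q b) IH => a IH h.
rewrite /dpsum /psum big_ord_recr/= [X in _ + _ * X]big_ord_recr/=.
rewrite -/(dpsum _ N.+1 t) -/(psum _ N.+1 t).
rewrite [_ * (dpsum _ _ _ + _)]mulrDr [_ * (psum _ _ _ + _)]mulrDr addrACA IH.
rewrite (_ : q * _ * a N.+2 = N.+2%:R * q * a N.+2); last by ring.
rewrite h -![N.+1%:R]natr1 !exprS; ring.
Qed.

(* With [S] the N-th Taylor polynomial and [Q] the quadratic, [S * Q^(3/2)] has
   derivative [sqrt Q] times the residual of [S] in the differential equation,
   which is of order [t^(N-1)]. *)
Lemma analytic0_inv_cube rho b d : 0 < d -> d <= rho -> `|b| <= rho ->
  analytic0 (fun t => (Num.sqrt (rho ^+ 2 + 2 * b * t + t ^+ 2) ^+ 3)^-1)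
    (cube_coef (rho ^+ 3)^-1 (rho ^+ 2) b) (4 / d ^+ 3) (d / 8).
Proof.
move=> d0 drho brho; have rho0 := lt_le_trans d0 drho.
set c := (rho ^+ 3)^-1; have c0 : 0 < c by rewrite invr_gt0 exprn_gt0.
pose Q t := rho ^+ 2 + 2 * b * t + t ^+ 2; rewrite -/(Q _).
(* With |t| <= rho / 8, the upper bound is (1 + 1/8)^2 rho^2; the lower one comes from 1 - 2/8 = 3/4
   >= (6/7)^2. *)
have Qb t : `|t| <= d / 8 -> (6 / 7 * rho) ^+ 2 <= Q t <= (9 / 8 * rho) ^+ 2.
  move=> td; have tr : `|t| <= rho / 8 by lra.
  have : `|b * t| <= rho * (rho / 8) by rewrite normrM ler_pM.
  have : `|t| ^+ 2 <= (rho / 8) ^+ 2 by rewrite lerXn2r ?nnegrE//; lra.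
  have : 0 <= t ^+ 2 by exact: sqr_ge0.
  rewrite real_normK ?num_real// ler_norml /Q => ? ? /andP[? ?].
  apply/andP; split; nra.
have Q0 t : `|t| <= d / 8 -> 0 < Q t.
  move=> /Qb/andP[+ _]; apply: lt_le_trans; rewrite exprn_gt0// mulr_gt0//.
have sQ t : `|t| <= d / 8 -> 6 / 7 * rho <= Num.sqrt (Q t) <= 9 / 8 * rho.
  move=> td; have /andP[Q1 Q2] := Qb t td.
  have sqrtE k : 0 <= k -> k * rho = Num.sqrt ((k * rho) ^+ 2).
    by move=> k0; rewrite sqrtr_sqr ger0_norm// mulr_ge0// ltW.
  by apply/andP; split; rewrite sqrtE// ler_wsqrtr.
(* (7/6)^3 < 8/5. *)
have gE t : `|t| <= d / 8 -> `|(Num.sqrt (Q t) ^+ 3)^-1| <= 8 / 5 / d ^+ 3.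
  move=> td; have /andP[Q1 _] := sQ t td.
  have d7 : 6 / 7 * d <= Num.sqrt (Q t) by lra.
  rewrite normfV ger0_norm ?exprn_ge0// -[leRHS]invf_div lef_pV2 ?posrE.
  - apply: (@le_trans _ _ ((6 / 7 * d) ^+ 3)); last by rewrite lerXn2r ?nnegrE//; lra.
    by rewrite exprMn; have := exprn_gt0 3 d0; lra.
  - by rewrite exprn_gt0// sqrtr_gt0 Q0.
  - by rewrite divr_gt0// exprn_gt0.
move=> [|M] t td.
  rewrite big_ord0 subr0 expr0 mulr1 (le_trans (gE _ td))//.
  by rewrite ler_pM2r ?invr_gt0 ?exprn_gt0//; lra.
rewrite -/(Q t) -/(psum _ _ t).
set a := cube_coef _ _ _.
pose h s := psum a M.+1 s * (Q s * Num.sqrt (Q s)).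
pose dh s := Num.sqrt (Q s) * (- (rho ^+ 2 * M.+1%:R * a M.+1 * s ^+ M) +
    (M%:R + 3) * a M * s ^+ M.+1).
have hd (s : R) : `|s| <= `|t| -> is_derive s 1 h (dh s).
  move=> st; have sd := le_trans st td.
  have dp := is_derive_psum a M.+1 s.
  have dQ : is_derive s 1 Q (2 * b + 2 * s).
    rewrite /Q; apply: is_derive_eq.
    by rewrite /GRing.scale/=; ring.
  have dsQ : is_derive s 1 (Num.sqrt \o Q) ((2 * Num.sqrt (Q s))^-1 * (2 * b + 2 * s)).
    apply: is_derive1_comp; exact: is_derive1_sqrt (Q0 _ sd).
  have -> : h = psum a M.+1 * (Q * (Num.sqrt \o Q)) by [].
  apply: is_derive_eq.
  rewrite /= /dh -cube_coef_residual ?expf_neq0 ?gt_eqF//.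
  rewrite /GRing.scale/= fctE/=.
  have : 0 < Num.sqrt (Q s) by rewrite sqrtr_gt0 Q0.
  have : Q s = Num.sqrt (Q s) ^+ 2 by rewrite sqr_sqrtr// ltW ?Q0.
  rewrite -/(Q s) -/a; move: (Num.sqrt (Q s)) => r -> r0.
  by field; rewrite gt_eqF.
have h0 : h 0 = 1.
  have Q00 : Q 0 = rho ^+ 2 by rewrite /Q expr0n/=; ring.
  rewrite /h Q00 sqrtr_sqr gtr0_norm// /psum big_ord_recl big1 => [|i _]; last first.
    by rewrite expr0n/= mulr0.
  by rewrite addr0 expr0 mulr1 -exprSr /= /c mulVf// expf_neq0// gt_eqF.
have [s st hE] := mean_value_at0 hd.
have sd := le_trans st td.
have dhb : `|dh s| <= 81 / 64 * M.+1%:R * (4 / d) ^+ M.+1 * `|t| ^+ M.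
  have cn n : `|a n| <= c * (4 / d) ^+ n by apply: cube_coef_le => //; exact: ltW.
  have l0 : 0 < 4 / d by rewrite divr_gt0.
  have [l0' s0 M0] : [/\ 0 <= 4 / d, 0 <= `|s| & 0 <= M%:R :> R] by rewrite ltW.
  set X := (4 / d) ^+ M.+1 * `|s| ^+ M.
  have X0 : 0 <= X by rewrite mulr_ge0// exprn_ge0.
  have res1 : `|rho ^+ 2 * M.+1%:R * a M.+1 * s ^+ M| <= (M%:R + 1) * (c * rho ^+ 2) * X.
    rewrite 3!normrM !normrX (gtr0_norm rho0) normr_nat -natr1.
    rewrite [leRHS](_ : _ = rho ^+ 2 * (M%:R + 1) * (c * (4 / d) ^+ M.+1) * `|s| ^+ M).
      by rewrite ler_wpM2r ?exprn_ge0// ler_wpM2l ?cn// mulr_ge0 ?sqr_ge0// addr_ge0.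
    by rewrite /X; ring.
  (* One surplus factor |s| <= d / 8 turns (4 / d)^M into (4 / d)^(M+1) d^2 / 32, and d <= rho. *)
  have res2 : `|(M%:R + 3) * a M * s ^+ M.+1| <= (M%:R + 3) * (c * rho ^+ 2) * X / 32.
    rewrite 2!normrM normrX ger0_norm ?addr_ge0//.
    apply: (@le_trans _ _ ((M%:R + 3) * (c * (4 / d) ^+ M) * (`|s| ^+ M * (d / 8)))).
      rewrite exprSr ler_pM ?mulr_ge0 ?exprn_ge0 ?addr_ge0//.
        by rewrite ler_wpM2l ?addr_ge0.
      by rewrite ler_wpM2l ?exprn_ge0.
    rewrite [leLHS](_ : _ = (M%:R + 3) * (c * d ^+ 2) * X / 32); last first.
      rewrite /X [(4 / d) ^+ M.+1]exprSr; move: ((4 / d) ^+ M) (`|s| ^+ M) => u v.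
      by field; rewrite gt_eqF.
    rewrite ler_wpM2r// ler_wpM2r// ler_wpM2l ?addr_ge0// ler_wpM2l ?(ltW c0)//.
    by rewrite lerXn2r ?nnegrE// ltW.
  have /andP[q1 q2] := sQ s sd.
  rewrite normrM ger0_norm ?sqrtr_ge0//.
  (* One factor 9/8 bounds the square root of [Q]; the other comes from (M + 1) + (M + 3) / 32 <=
     9/8 (M + 1). *)
  apply: (@le_trans _ _ (9 / 8 * rho * (9 / 8 * (M%:R + 1) * (c * rho ^+ 2) * X))).
    rewrite ler_pM ?sqrtr_ge0// (le_trans (ler_normD _ _))// normrN.
    apply: (le_trans (lerD res1 res2)).
    have Y0 : 0 <= c * rho ^+ 2 * X by rewrite mulr_ge0// mulr_ge0 ?sqr_ge0// ltW.
    have Y1 : 0 <= M%:R * (c * rho ^+ 2 * X) by rewrite mulr_ge0.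
    lra.
  rewrite -[M.+1%:R]natr1 [leLHS](_ : _ = 81 / 64 * (M%:R + 1) * (c * rho ^+ 3) * X);
    last by field.
  rewrite /c mulVf ?expf_neq0 ?gt_eqF// mulr1 -[leRHS]mulrA ler_wpM2l ?mulr_ge0 ?addr_ge0//.
  by rewrite ler_wpM2l ?exprn_ge0// lerXn2r ?nnegrE.
have {hE dhb} hb : `|1 - h t| <= 81 / 64 * (`|t| / (d / 8)) ^+ M.+1.
  rewrite distrC -[X in _ - X]h0 hE normrM.
  apply: (le_trans (ler_wpM2r (normr_ge0 t) dhb)).
  rewrite [leLHS](_ : _ = 81 / 64 * (M.+1%:R * (4 / d * `|t|) ^+ M.+1)); last first.
    by rewrite [(4 / d * _) ^+ _]exprMn [`|t| ^+ M.+1]exprSr; ring.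
  rewrite ler_wpM2l//.
  (* The coefficient bound alone would allow the radius d / 4. Halving it yields a factor 2^(M+1),
     which absorbs the M+1 produced by differentiation. *)
  rewrite [X in _ <= X ^+ _](_ : _ = 2 * (4 / d * `|t|)); last by field; rewrite gt_eqF.
  rewrite [leRHS]exprMn ler_wpM2r ?exprn_ge0 ?mulr_ge0 ?invr_ge0 ?(ltW d0)//.
  by rewrite -natrX ler_nat ltnW// ltn_expl.
have -> : (Num.sqrt (Q t) ^+ 3)^-1 - psum a M.+1 t = (1 - h t) * (Num.sqrt (Q t) ^+ 3)^-1.
  have sQ0 : Num.sqrt (Q t) != 0 by rewrite gt_eqF// sqrtr_gt0 Q0.
  have -> : h t = psum a M.+1 t * Num.sqrt (Q t) ^+ 3.
    by rewrite /h [Num.sqrt _ ^+ 3]exprSr sqr_sqrtr// ltW// Q0.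
  by rewrite [RHS]mulrDl mul1r mulNr mulfK// expf_neq0.
rewrite normrM.
(* The product 81/64 * 8/5 is below the constant 4 of the statement. *)
have := ler_pM (normr_ge0 _) (normr_ge0 _) hb (gE _ td).
move/le_trans; apply.
set x := _ ^+ M.+1; have x0 : 0 <= x by rewrite exprn_ge0// divr_ge0// ltW// divr_gt0.
have y0 : 0 < (d ^+ 3)^-1 by rewrite invr_gt0 exprn_gt0.
nra.
Qed.
End inverse_cube_expansion.

(** * Euclidean geometry of R^3 *)

Section euclidean_geometry.
Context {R : realType}.
Implicit Types (x y z v : 'rV[R]_3) (k r t : R).

Lemma dotE x y : dot x y =
  x 0 0 * y 0 0 + x 0 1 * y 0 1 + x 0 2 * y 0 2.
Proof.
rewrite /dot !big_ord_recl big_ord0 addr0 addrA.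
by congr (_ * _ + _ * _ + _ * _); congr (_ 0 _); exact: val_inj.
Qed.

Lemma dotC x y : dot x y = dot y x.
Proof. by apply: eq_bigr => i _; rewrite mulrC. Qed.

Lemma dotDl x y z : dot (x + y) z = dot x z + dot y z.
Proof. by rewrite !dotE !mxE; ring. Qed.

Lemma dotZl k x y : dot (k *: x) y = k * dot x y.
Proof. by rewrite !dotE !mxE; ring. Qed.

Lemma dotNl x y : dot (- x) y = - dot x y.
Proof. by rewrite !dotE !mxE; ring. Qed.

Lemma dotDr x y z : dot x (y + z) = dot x y + dot x z.
Proof. by rewrite !dotE !mxE; ring. Qed.

Lemma dotZr k x y : dot x (k *: y) = k * dot x y.
Proof. by rewrite !dotE !mxE; ring. Qed.

Lemma dotNr x y : dot x (- y) = - dot x y.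
Proof. by rewrite !dotE !mxE; ring. Qed.

Definition dot_lin := (dotDl, dotDr, dotZl, dotZr, dotNl, dotNr).

Lemma dotxx_ge0 x : 0 <= dot x x.
Proof. by apply: sumr_ge0 => i _; rewrite -expr2 sqr_ge0. Qed.

Lemma enorm_ge0 x : 0 <= enorm x.
Proof. exact: sqrtr_ge0. Qed.

Lemma sqr_enorm x : enorm x ^+ 2 = dot x x.
Proof. by rewrite sqr_sqrtr// dotxx_ge0. Qed.

Lemma enorm0 : enorm (0 : 'rV[R]_3) = 0.
Proof. by rewrite /enorm dotE !mxE !mulr0 !addr0 sqrtr0. Qed.

Lemma enormZ k x : enorm (k *: x) = `|k| * enorm x.
Proof.
by rewrite /enorm !dot_lin mulrA -expr2 sqrtrM ?sqr_ge0// sqrtr_sqr.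
Qed.

Lemma enormN x : enorm (- x) = enorm x.
Proof. by rewrite /enorm !dot_lin opprK. Qed.

Lemma enormBC x y : enorm (x - y) = enorm (y - x).
Proof. by rewrite -opprB enormN. Qed.

(** Lagrange's identity: the difference of the two squares is the squared length of the cross
    product. *)
Lemma cauchy_schwarz x y : `|dot x y| <= enorm x * enorm y.
Proof.
rewrite -(@ler_pXn2r _ 2%N) ?nnegrE ?mulr_ge0 ?enorm_ge0//.
rewrite exprMn !sqr_enorm real_normK ?num_real//.
rewrite -subr_ge0 (_ : _ - _ =
  (x 0 0 * y 0 1 - x 0 1 * y 0 0) ^+ 2 + (x 0 1 * y 0 2 - x 0 2 * y 0 1) ^+ 2 +
  (x 0 2 * y 0 0 - x 0 0 * y 0 2) ^+ 2); last by rewrite !dotE; ring.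
by rewrite !addr_ge0// sqr_ge0.
Qed.

Lemma enormD x y : enorm (x + y) <= enorm x + enorm y.
Proof.
rewrite -(@ler_pXn2r _ 2%N) ?nnegrE ?addr_ge0 ?enorm_ge0//.
rewrite sqr_enorm !dot_lin (dotC y x) sqrrD !sqr_enorm.
by have := le_trans (ler_norm _) (cauchy_schwarz x y); lra.
Qed.

Lemma enormB_ge x y : enorm x - enorm y <= enorm (x - y).
Proof. by rewrite lerBlDr -{1}(subrK y x) enormD. Qed.

Lemma enorm_coord x i : `|x 0 i| <= enorm x.
Proof.
rewrite -sqrtr_sqr ler_wsqrtr// /dot (bigD1 i)//= -expr2 lerDl.
by apply: sumr_ge0 => j _; rewrite -expr2 sqr_ge0.
Qed.

Lemma enorm_le_norm x : enorm x <= 2 * `|x|.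
Proof.
rewrite -(@ler_pXn2r _ 2%N) ?nnegrE ?mulr_ge0 ?enorm_ge0//.
have c i : x 0 i * x 0 i <= `|x| ^+ 2.
  rewrite -expr2 -real_normK ?num_real// lerXn2r ?nnegrE//.
  rewrite [leRHS]/Num.Def.normr/= mx_normrE.
  exact: (le_bigmax _ (fun ij : 'I_1 * 'I_3 => `|x ij.1 ij.2|) (0, i)).
rewrite sqr_enorm dotE exprMn.
have := c 0; have := c 1; have := c 2; have := sqr_ge0 `|x|; lra.
Qed.

Lemma norm_le_enorm x : `|x| <= enorm x.
Proof.
rewrite [leLHS]/Num.Def.normr/= mx_normrE; apply: bigmax_le; first exact: enorm_ge0.
by move=> [i j] _ /=; rewrite ord1 enorm_coord.
Qed.

Lemma enorm_delta (i : 'I_3) : enorm (delta_mx 0 i : 'rV[R]_3) = 1.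
Proof.
rewrite /enorm /dot (bigD1 i)//= big1 => [|j ji].
  by rewrite !mxE !eqxx mulr1 addr0 sqrtr1.
by rewrite !mxE (negbTE ji) andbF mulr0.
Qed.

(** Lets expansions along unit directions reach every point; for y = x the direction is an arbitrary
    basis vector. *)
Lemma unit_direction x y : exists2 v : 'rV[R]_3, enorm v = 1 &
  y = x + enorm (y - x) *: v.
Proof.
have [e0|e0] := eqVneq (enorm (y - x)) 0.
  exists (delta_mx 0 0); first exact: enorm_delta.
  rewrite e0 scale0r addr0; apply/eqP; rewrite -subr_eq0 -normr_le0 -e0.
  exact: norm_le_enorm.
exists ((enorm (y - x))^-1 *: (y - x)).
  by rewrite enormZ normfV ger0_norm ?enorm_ge0// mulVf.
by rewrite scalerA divff// scale1r addrC subrK.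
Qed.

Lemma sqr_enorm_line x v t : enorm v = 1 ->
  enorm (x + t *: v) ^+ 2 = enorm x ^+ 2 + 2 * dot v x * t + t ^+ 2.
Proof.
move=> v1; have := sqr_enorm v; rewrite v1 expr1n => vv.
by rewrite !sqr_enorm !dot_lin -vv (dotC x v); ring.
Qed.

Lemma dist_line x v t : enorm v = 1 -> enorm (x + t *: v - x) = `|t|.
Proof. by move=> v1; rewrite addrC addKr enormZ v1 mulr1. Qed.

End euclidean_geometry.

(** * Functions that are harmonic at a point *)

Section harmonic_functions.
Context {R : realType}.
Implicit Types (F G : 'rV[R]_3 -> R) (x y z v : 'rV[R]_3) (r e t k : R).

(* [F] is analytic at [x] along every line, with a uniform radius [r], and the
   second-order Taylor coefficients say that its Laplacian at [x] vanishes. *)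
Definition harmonic_at F x r := exists C : R,
  exists2 a : 'rV[R]_3 -> nat -> R,
    forall v, enorm v = 1 -> analytic0 (fun t => F (x + t *: v)) (a v) C r &
    \sum_(i < 3) a (delta_mx 0 i) 2%N = 0.

Lemma harmonic_at_le F x r (r' : R) : 0 < r' -> r' <= r ->
  harmonic_at F x r -> harmonic_at F x r'.
Proof.
move=> r'0 r'r [C [a Fa a0]]; exists C, a => // v v1.
exact: analytic0_le (Fa v v1).
Qed.

Lemma harmonic_atD F G x r : harmonic_at F x r -> harmonic_at G x r ->
  harmonic_at (fun y => F y + G y) x r.
Proof.
move=> [C [a Fa a0]] [D [b Gb b0]]; exists (C + D), (fun v n => a v n + b v n).
  by move=> v v1; apply: analytic0D; [exact: Fa|exact: Gb].
by rewrite big_split/= a0 b0 addr0.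
Qed.

Lemma harmonic_atZ F x r k : harmonic_at F x r ->
  harmonic_at (fun y => k * F y) x r.
Proof.
move=> [C [a Fa a0]]; exists (`|k| * C), (fun v n => k * a v n).
  by move=> v v1; apply: analytic0Z; exact: Fa.
by rewrite -mulr_sumr a0 mulr0.
Qed.

Lemma eq_harmonic_at F G x r : 0 < r ->
  (forall y, enorm (y - x) <= r -> F y = G y) -> harmonic_at F x r ->
  harmonic_at G x r.
Proof.
move=> r0 FG [C [a Fa a0]]; exists C, a => // v v1 N t tr.
by rewrite -FG ?dist_line//; exact: Fa.
Qed.

Definition vanishes_near F x := exists2 e, 0 < e &
  forall y, enorm (y - x) < e -> F y = 0.

Lemma harmonic_at_flat F x r y : 0 < r -> harmonic_at F x r ->
  vanishes_near F x -> enorm (y - x) < r -> F y = 0.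
Proof.
move=> r0 [C [a Fa _]] [e e0 Fe] yr.
have [v v1 yE] := unit_direction x y; rewrite yE.
apply: (analytic0_flat r0 e0 (Fa v v1)) => [t te|].
  by rewrite Fe// dist_line.
by rewrite ger0_norm// enorm_ge0.
Qed.

Lemma vanishes_near_step F x r y : 0 < r -> harmonic_at F x r ->
  vanishes_near F x -> enorm (y - x) < r -> vanishes_near F y.
Proof.
move=> r0 Fx Fx0 yr; exists (r - enorm (y - x)); first by rewrite subr_gt0.
move=> z zy; apply: (harmonic_at_flat r0 Fx Fx0).
rewrite -(subrKA y) (le_lt_trans (enormD _ _))//; lra.
Qed.

(** A chain of balls: the path is cut into more than L / r pieces, so that each division point lies
    in the ball of radius [r] about the previous one, where the identity theorem along lines
    applies. *)
Lemma vanishes_along_path F (g : R -> 'rV[R]_3) (L r : R) : 0 < r ->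
  (forall s t : R, enorm (g s - g t) <= L * `|s - t|) ->
  (forall s : R, 0 <= s <= 1 -> harmonic_at F (g s) r) ->
  vanishes_near F (g 0) -> vanishes_near F (g 1).
Proof.
move=> r0 gL Fg F0.
have L0 : 0 <= L.
  by have := gL 1 0; rewrite subr0 normr1 mulr1; apply: le_trans; exact: enorm_ge0.
have [N /= LN] : exists N : nat, L / r < N.+1%:R.
  exists (Num.truncn (L / r)); exact: truncnS_gt.
have N0 : 0 < N.+1%:R :> R by rewrite ltr0n.
suff H (k : nat) : (k <= N.+1)%N -> vanishes_near F (g (k%:R / N.+1%:R)).
  by have := H N.+1 (leqnn _); rewrite divff ?gt_eqF.
elim: k => [_|k IH kN]; first by rewrite mul0r.
apply: (vanishes_near_step r0 _ (IH (ltnW kN))).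
  apply: Fg; rewrite divr_ge0//= ler_pdivrMr// mul1r ler_nat; exact: ltnW.
apply: (le_lt_trans (gL _ _)).
rewrite -mulrBl -natrB// subSnn mul1r ger0_norm ?invr_ge0//.
by rewrite ltr_pdivrMr// mulrC -ltr_pdivrMr.
Qed.

Lemma harmonic_at_continuous F x r : 0 < r -> harmonic_at F x r ->
  forall e, 0 < e -> exists2 d : R, 0 < d &
    forall y, enorm (y - x) < d -> `|F y - F x| < e.
Proof.
move=> r0 [C [a Fa _]] e e0.
have C0 : 0 <= C by apply: (analytic0_ge0 r0 (Fa _ (enorm_delta 0))).
have D0 : 0 < C / r + 1 by rewrite ltr_wpDl// divr_ge0// ltW.
exists (Num.min r (e / (C / r + 1))); first by rewrite lt_min r0 divr_gt0.
move=> y; rewrite lt_min => /andP[yr ye].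
have [v v1 yE] := unit_direction x y.
have := Fa v v1 1%N (enorm (y - x)).
rewrite ger0_norm ?enorm_ge0// => /(_ (ltW yr)).
rewrite big_ord1 expr0 mulr1 -(analytic0_value r0 (Fa v v1)) scale0r addr0 -yE expr1.
move=> /le_lt_trans; apply.
move: ye; rewrite ltr_pdivlMr//; apply: le_lt_trans.
by have := enorm_ge0 (y - x); lra.
Qed.

(** Adding the third-order expansions at t and -t along a basis vector cancels the odd terms. Summed
    over the basis, the second coefficients cancel too, which leaves e t^2 <= C (t / r)^3, false for
    small t. *)
Lemma harmonic_at_no_strict_max F x r e (d : R) : 0 < r -> 0 < e -> 0 < d ->
  harmonic_at F x r ->
  ~ (forall y, enorm (y - x) < d ->
      F y + e * enorm y ^+ 2 <= F x + e * enorm x ^+ 2).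
Proof.
move=> r0 e0 d0 [C [a Fa a0]] Fmax.
have C0 : 0 <= C by apply: (analytic0_ge0 r0 (Fa _ (enorm_delta 0))).
have C1 : 0 < C + 1 by lra.
(* The last bound gives (C + 1) t <= e r^3, hence the strict C t < e r^3 that contradicts the summed
   inequality. *)
pose t := Num.min r (Num.min (d / 2) (e * r ^+ 3 / (C + 1))).
have er0 : 0 < e * r ^+ 3 by rewrite mulr_gt0// exprn_gt0.
have t0 : 0 < t by rewrite !lt_min r0 (divr_gt0 d0)//= divr_gt0.
have tr : t <= r by rewrite ge_min lexx.
have td : t < d.
  rewrite !gt_min; apply/orP; right; apply/orP; left.
  by rewrite ltr_pdivrMr// ltr_pMr// ltr1n.
have te : (C + 1) * t <= e * r ^+ 3.
  by rewrite mulrC -ler_pdivlMr// !ge_min lexx !orbT.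
clearbody t.
have key (i : 'I_3) : a (delta_mx 0 i) 2%N * t ^+ 2 - C * (t / r) ^+ 3 <= - e * t ^+ 2.
  have v1 := @enorm_delta R i; set v := delta_mx 0 i in v1 *.
  have h1 := Fa v v1 3%N t; have h2 := Fa v v1 3%N (- t).
  rewrite normrN gtr0_norm// in h1 h2; move: (h1 tr) (h2 tr).
  rewrite !big_ord_recr !big_ord0 /= -!(analytic0_value r0 (Fa v v1)) scale0r addr0.
  rewrite !expr0 !expr1 sqrrN.
  have := Fmax (x + t *: v); rewrite dist_line// gtr0_norm// => /(_ td).
  have := Fmax (x + (- t) *: v); rewrite dist_line// normrN gtr0_norm// => /(_ td).
  rewrite !sqr_enorm_line// sqrrN !ler_norml => ? ? /andP[? ?] /andP[? ?].
  lra.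
have : \sum_(i < 3) (a (delta_mx 0 i) 2%N * t ^+ 2 - C * (t / r) ^+ 3) <=
       \sum_(i < 3) (- e * t ^+ 2) by apply: ler_sum => i _; exact: key.
rewrite big_split/= -mulr_suml a0 mul0r add0r !sumr_const card_ord lerMn2r/=.
rewrite mulNr lerN2 (_ : C * _ = C * t / r ^+ 3 * t ^+ 2); last first.
  by field; rewrite gt_eqF.
rewrite ler_pM2r ?exprn_gt0// ler_pdivlMr ?exprn_gt0//.
by move: te; lra.
Qed.

End harmonic_functions.

(** * The maximum principle on the whole space *)

Section maximum_principle.
Context {R : realType}.
Implicit Types (F : 'rV[R]_3 -> R) (x y : 'rV[R]_3).

(** Phrased with the Euclidean distance, in which all estimates are made; the sup-norm topology
    enters only through compactness. *)
Definition econtinuous F := forall x (e : R), 0 < e -> exists2 d : R, 0 < d &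
  forall y, enorm (y - x) < d -> `|F y - F x| < e.

Definition vanishes_at_infinity F := forall e : R, 0 < e -> exists L : R,
  forall x, L <= enorm x -> `|F x| <= e.

Lemma econtinuous_continuous F : econtinuous F -> continuous F.
Proof.
move=> Fc x s /= /(nbhs_ballP (F x))[e /= e0 es].
have [d d0 Fd] := Fc x e e0.
apply/nbhs_ballP; exists (d / 2); first by rewrite /= divr_gt0.
move=> y; rewrite -ball_normE/= => xy; apply: es.
rewrite -ball_normE/= distrC; apply: Fd.
by rewrite enormBC (le_lt_trans (enorm_le_norm _))// mulrC -ltr_pdivlMr.
Qed.

Lemma econtinuous_sqr_enorm : econtinuous (fun x => enorm x ^+ 2).
Proof.
move=> x e e0.
have D0 : 0 < 2 * enorm x + 1 by have := enorm_ge0 x; lra.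
exists (Num.min 1 (e / (2 * enorm x + 1))).
  by rewrite lt_min ltr01 divr_gt0.
move=> y; rewrite lt_min ltr_pdivlMr// => /andP[y1 ye].
rewrite (_ : _ - _ = (enorm y - enorm x) * (enorm y + enorm x)); last by ring.
have d1 : `|enorm y - enorm x| <= enorm (y - x).
  rewrite ler_norml enormB_ge andbT.
  by have := enormB_ge x y; rewrite enormBC; lra.
apply: le_lt_trans ye; rewrite normrM ler_pM//.
by have := enormB_ge y x; rewrite ger0_norm ?addr_ge0 ?enorm_ge0//; lra.
Qed.

Lemma compact_norm_le (L : R) : compact [set x : 'rV[R]_3 | `|x| <= L].
Proof.
apply: bounded_closed_compact.
  exists L; split; first exact: num_real.
  by move=> M LM x /= xL; exact: le_trans xL (ltW LM).
have := @closed_comp _ _ (fun x : 'rV[R]_3 => `|x|) [set r | r <= L] _ (@closed_le R L).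
by apply; move=> x _; exact: norm_continuous.
Qed.

(* The barrier [e |x|^2] turns a maximum into a strictly subharmonic one. *)
Lemma harmonic_le0 F : econtinuous F ->
  (forall x, F x <> 0 -> exists2 r, 0 < r & harmonic_at F x r) ->
  vanishes_at_infinity F -> forall x, F x <= 0.
Proof.
move=> Fc Fh Foo x0; rewrite leNgt; apply/negP => F0.
have [L0 FL0] := Foo _ (divr_gt0 F0 (ltr0n R 2)).
pose L := Num.max 1 L0.
have L1 : 1 <= L by rewrite le_max lexx.
have FL x : L <= enorm x -> `|F x| <= F x0 / 2.
  by move=> xL; apply: FL0; apply: le_trans xL; rewrite le_max lexx orbT.
clearbody L.
have x0L : enorm x0 < L.
  rewrite ltNge; apply/negP => /FL; rewrite gtr0_norm//; lra.
(* A point of sup norm at most [L] has Euclidean norm at most 2L, so the barrier is at most F x0 / 4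
   there. Where |x| >= L, [F] is at most F x0 / 2, so a maximum of value at least F x0 cannot lie
   there. *)
pose e := F x0 / (16 * L ^+ 2).
have L2 : 0 < L ^+ 2 by rewrite exprn_gt0//; lra.
have e0 : 0 < e by rewrite divr_gt0// mulr_gt0.
have eL : e * L ^+ 2 = F x0 / 16.
  by rewrite /e; field; apply/eqP => L0'; move: L1; rewrite L0'; lra.
clearbody e.
pose G x := F x + e * enorm x ^+ 2.
have [z] : exists2 z, z \in [set x : 'rV[R]_3 | `|x| <= L] &
    forall t, t \in [set x : 'rV[R]_3 | `|x| <= L] -> G t <= G z.
  apply: EVT_max_rV; [|exact: compact_norm_le|].
    by exists 0; rewrite /= normr0; lra.
  apply: continuous_subspaceT; apply: econtinuous_continuous => x d d0.
  have [d1 d10 Fd] := Fc x (d / 2) (divr_gt0 d0 (ltr0n R 2)).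
  have [d2 d20 qd] := econtinuous_sqr_enorm x (divr_gt0 (divr_gt0 d0 (ltr0n R 2)) e0).
  exists (Num.min d1 d2); first by rewrite lt_min d10.
  move=> y; rewrite lt_min => /andP[/Fd Fy /qd qy].
  rewrite /G opprD addrACA -mulrBr (le_lt_trans (ler_normD _ _))//.
  rewrite normrM (gtr0_norm e0) (splitr d) ltrD//.
  by rewrite mulrC -ltr_pdivlMr.
rewrite inE/= => zL zmax.
have Gz : F x0 <= G z.
  have : G x0 <= G z.
    by apply: zmax; rewrite inE/= (le_trans (norm_le_enorm _))// ltW.
  by apply: le_trans; rewrite lerDl mulr_ge0 ?exprn_ge0 ?enorm_ge0// ltW.
have ez : e * enorm z ^+ 2 <= F x0 / 4.
  have : enorm z ^+ 2 <= (2 * L) ^+ 2.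
    rewrite lerXn2r ?nnegrE ?enorm_ge0//; first lra.
    by rewrite (le_trans (enorm_le_norm _))// ler_wpM2l.
  move=> /(ler_wpM2l (ltW e0)); rewrite exprMn; lra.
have zL' : enorm z < L.
  rewrite ltNge; apply/negP => /FL; rewrite ler_norml => /andP[_ ?].
  by move: Gz; rewrite /G; lra.
(* At [z] the barrier accounts for at most a quarter of F x0, so F z is nonzero and harmonicity is
   available. *)
have [r r0 Fr] : exists2 r, 0 < r & harmonic_at F z r.
  by apply: Fh => Fz; move: Gz; rewrite /G Fz; lra.
have d0 : 0 < L - enorm z by lra.
apply: (harmonic_at_no_strict_max r0 e0 d0 Fr) => y yz.
apply: zmax; rewrite inE/= (le_trans (norm_le_enorm _))//.
by have := enormB_ge y z; lra.
Qed.

Lemma harmonic_eq0 F : econtinuous F ->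
  (forall x, F x <> 0 -> exists2 r, 0 < r & harmonic_at F x r) ->
  vanishes_at_infinity F -> forall x, F x = 0.
Proof.
move=> Fc Fh Foo x; apply/eqP; rewrite eq_le harmonic_le0//=.
have := @harmonic_le0 (fun y => - 1 * F y) _ _ _ x.
rewrite mulN1r oppr_le0; apply.
- move=> y e /(Fc y)[d d0 Fd]; exists d => // z /Fd.
  by rewrite !mulN1r -opprD normrN.
- move=> y; rewrite mulN1r => Fy.
  have [|r r0 Fr] := Fh y; first by move=> Fy0; apply: Fy; rewrite Fy0 oppr0.
  by exists r => //; exact: harmonic_atZ.
- move=> e /Foo[L FL]; exists L => y /FL.
  by rewrite mulN1r normrN.
Qed.

End maximum_principle.

(** * Potentials of kernels *)

Section kernel_potentials.
Context {R : realType} d (T : measurableType d) (mu : {measure set T -> \bar R}).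
Context (K : set T) (f : T -> R).
Hypotheses (mK : measurable K) (fi : mu.-integrable K (EFin \o f)).
Implicit Types (g : T -> R) (C : R).

Lemma integrable_mul_bounded g C : measurable_fun K g ->
  (forall y, K y -> `|g y| <= C) -> mu.-integrable K (EFin \o (fun y => f y * g y)).
Proof.
move=> mg gC.
have gb : [bounded g y | y in K].
  exists C; split; first exact: num_real.
  by move=> M CM y /gC gy; exact: le_trans gy (ltW CM).
have := integrableMl mK fi mg gb.
by apply: eq_integrable => // y _; rewrite /= EFinM.
Qed.

Lemma le_normr_integral_mul g C : measurable_fun K g ->
  (forall y, K y -> `|g y| <= C) ->
  `|\int[mu]_(y in K) (f y * g y)| <= C * \int[mu]_(y in K) `|f y|.
Proof.
move=> mg gC; have gi := integrable_mul_bounded mg gC.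
apply: (le_trans (le_normr_Rintegral mK gi)).
have nfi : mu.-integrable K (EFin \o (fun y => `|f y|)) by exact: integrable_norm.
rewrite -RintegralZl//; apply: le_Rintegral => //.
- exact: integrable_norm gi.
- have := integrableZl mK C nfi.
  by apply: eq_integrable => // y _; rewrite /= EFinM.
- by move=> y Ky; rewrite normrM mulrC ler_wpM2r// gC.
Qed.

Lemma measurable_psum (a : nat -> T -> R) N t : (forall n, measurable_fun K (a n)) ->
  measurable_fun K (fun y => \sum_(n < N) a n y * t ^+ n).
Proof. by move=> ma; apply: measurable_sum => n; exact: measurable_funM. Qed.

Lemma integral_mul_psum (a : nat -> T -> R) (B : nat -> R) N t :
  (forall n, measurable_fun K (a n)) -> (forall n y, K y -> `|a n y| <= B n) ->
  \int[mu]_(y in K) (f y * \sum_(n < N) a n y * t ^+ n) =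
  \sum_(n < N) (\int[mu]_(y in K) (f y * a n y)) * t ^+ n.
Proof.
move=> ma aB; have ai n := integrable_mul_bounded (ma n) (aB n).
elim: N => [|N IH].
  rewrite big_ord0 (@eq_Rintegral _ _ _ _ _ (cst 0)) => [|y _].
    by rewrite Rintegral_cst// mul0r.
  by rewrite big_ord0 mulr0.
have si : mu.-integrable K (EFin \o (fun y => f y * \sum_(n < N) a n y * t ^+ n)).
  apply: (@integrable_mul_bounded _ (\sum_(n < N) B n * `|t| ^+ n)).
    exact: measurable_psum.
  move=> y Ky; rewrite (le_trans (ler_norm_sum _ _ _))// ler_sum// => n _.
  by rewrite normrM normrX ler_wpM2r ?exprn_ge0// aB.
rewrite big_ord_recr/= -IH -RintegralZr// -RintegralD//; last first.
  have := integrableZl mK (t ^+ N) (ai N).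
  by apply: eq_integrable => // y _; rewrite /= -EFinM mulrC.
by apply: eq_Rintegral => y _; rewrite big_ord_recr/= mulrDr mulrA.
Qed.

(** The remainder of the integral is the integral of the remainders; since [C] and [r] are the same
    for all y in [K], the bound comes out of the integral. *)
Lemma integral_mul_analytic0 (k : R -> T -> R) (a : nat -> T -> R) C r : 0 < r ->
  (forall t : R, measurable_fun K (k t)) -> (forall n, measurable_fun K (a n)) ->
  (forall y, K y -> analytic0 (k ^~ y) (a ^~ y) C r) ->
  analytic0 (fun t => \int[mu]_(y in K) (f y * k t y))
    (fun n => \int[mu]_(y in K) (f y * a n y))
    (C * \int[mu]_(y in K) `|f y|) r.
Proof.
move=> r0 mk ma ka N t tr.
have aB n y : K y -> `|a n y| <= 2 * C / r ^+ n.
  by move=> Ky; exact: (analytic0_coef n r0 (ka y Ky)).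
have kC y : K y -> `|k t y| <= C by move=> Ky; exact: analytic0_bound (ka y Ky) tr.
rewrite -(integral_mul_psum _ _ ma aB) -RintegralB//; last 2 first.
- exact: integrable_mul_bounded kC.
- apply: (@integrable_mul_bounded _ (\sum_(n < N) (2 * C / r ^+ n) * `|t| ^+ n)).
    exact: measurable_psum.
  move=> y Ky; rewrite (le_trans (ler_norm_sum _ _ _))// ler_sum// => n _.
  by rewrite normrM normrX ler_wpM2r ?exprn_ge0// aB.
rewrite mulrAC.
under eq_Rintegral do rewrite -mulrBr.
apply: le_normr_integral_mul.
  by apply: measurable_funB => //; exact: measurable_psum.
by move=> y Ky; exact: ka.
Qed.

Lemma integral_mul_harmonic (k : 'rV[R]_3 -> T -> R)
    (a : 'rV[R]_3 -> nat -> T -> R) C r x : 0 < r ->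
  (forall x, measurable_fun K (k x)) -> (forall v n, measurable_fun K (a v n)) ->
  (forall v y, enorm v = 1 -> K y ->
     analytic0 (fun t => k (x + t *: v) y) (fun n => a v n y) C r) ->
  (forall y, K y -> \sum_(i < 3) a (delta_mx 0 i) 2%N y = 0) ->
  harmonic_at (fun x => \int[mu]_(y in K) (f y * k x y)) x r.
Proof.
move=> r0 mk ma ka a0.
exists (C * \int[mu]_(y in K) `|f y|), (fun v n => \int[mu]_(y in K) (f y * a v n y)).
  move=> v v1.
  apply: (@integral_mul_analytic0 (fun t => k (x + t *: v)) (a v)) => // y Ky.
  exact: ka.
have ai i : mu.-integrable K (EFin \o (fun y => f y * a (delta_mx 0 i) 2%N y)).
  apply: (@integrable_mul_bounded _ (2 * C / r ^+ 2)) => // y Ky.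
  exact: (analytic0_coef 2 r0 (ka _ y (enorm_delta i) Ky)).
have aij i j : mu.-integrable K (EFin \o (fun y =>
    f y * a (delta_mx 0 i) 2%N y + f y * a (delta_mx 0 j) 2%N y)).
  have := integrableD mK (ai i) (ai j).
  by apply: eq_integrable => // y _; rewrite /= EFinD.
rewrite !big_ord_recr big_ord0/= add0r -!RintegralD//.
rewrite (@eq_Rintegral _ _ _ _ _ (cst 0)) => [|y /set_mem Ky].
  by rewrite Rintegral_cst// mul0r.
rewrite -!mulrDr (_ : _ + _ = 0) ?mulr0//.
by have := a0 y Ky; rewrite !big_ord_recr big_ord0/= add0r.
Qed.

End kernel_potentials.

(** * Measurability and line expansions of the kernel |x - y|^-3 *)

Section newtonian_kernels.
Context {R : realType}.
Implicit Types (x y z v : 'rV[R]_3) (d r t M : R).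

Lemma measurable_coord i : measurable_fun setT (fun y : 'rV[R]_3 => y 0 i).
Proof.
apply: (measurability _ (RGenOpens.measurableE R)).
move=> _ [_ [a [b ->]] <-]; rewrite setTI; apply: sub_sigma_algebra.
by have /continuousP := @coord_continuous R 1 3 0 i; apply; exact: interval_open.
Qed.

Lemma measurable_sub_coord x i : measurable_fun setT (fun y : 'rV[R]_3 => (x - y) 0 i).
Proof.
under eq_fun do rewrite !mxE.
by apply: measurable_funB => //; exact: measurable_coord.
Qed.

Lemma measurable_dot_sub x v : measurable_fun setT (fun y : 'rV[R]_3 => dot v (x - y)).
Proof.
by apply: measurable_sum => i; apply: measurable_funM => //; exact: measurable_sub_coord.
Qed.

(** The inverse is rewritten as the real power -1; both take the value 0 at 0. *)
Lemma measurable_fun_inv_nonneg (g : 'rV[R]_3 -> R) : (forall y, 0 <= g y) ->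
  measurable_fun setT g -> measurable_fun setT (fun y => (g y)^-1).
Proof.
move=> g0 mg; under eq_fun do rewrite -powR_inv1//.
exact: (measurableT_comp (measurable_powR _) mg).
Qed.

Lemma measurable_enorm_sub x : measurable_fun setT (fun y : 'rV[R]_3 => enorm (x - y)).
Proof.
have m : measurable_fun setT (fun y : 'rV[R]_3 => dot (x - y) (x - y)).
  by apply: measurable_sum => i; apply: measurable_funM; exact: measurable_sub_coord.
rewrite (_ : (fun _ => _) = (fun y : 'rV[R]_3 => dot (x - y) (x - y) `^ 2^-1)).
  exact: (measurableT_comp (measurable_powR _) m).
by apply/funext => y; rewrite powR12_sqrt// dotxx_ge0.
Qed.

Lemma measurable_inv_enorm_exp x n :
  measurable_fun setT (fun y : 'rV[R]_3 => (enorm (x - y) ^+ n)^-1).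
Proof.
apply: measurable_fun_inv_nonneg => [y|]; first by rewrite exprn_ge0// enorm_ge0.
by apply: measurable_funX; exact: measurable_enorm_sub.
Qed.

(* The Taylor coefficients of [t |-> |x + t v - y|^-3]. *)
Definition cube_taylor x v n y : R :=
  cube_coef (enorm (x - y) ^+ 3)^-1 (enorm (x - y) ^+ 2) (dot v (x - y)) n.

Lemma measurable_cube_taylor x v n : measurable_fun setT (cube_taylor x v n).
Proof.
suff : measurable_fun setT (cube_taylor x v n) /\
       measurable_fun setT (cube_taylor x v n.+1) by case.
have m0 : measurable_fun setT (cube_taylor x v 0) by exact: measurable_inv_enorm_exp.
have mS k (h : 'rV[R]_3 -> R) : measurable_fun setT (cube_taylor x v k) ->
    measurable_fun setT h ->
    measurable_fun setT (fun y => - ((2 * k%:R + 3) * dot v (x - y) * cube_taylor x v k y +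
      h y) / (k.+1%:R * enorm (x - y) ^+ 2)).
  move=> mk mh; apply: measurable_funM.
    apply: measurable_funN; apply: measurable_funD => //; apply: measurable_funM => //.
    by apply: measurable_funM => //; exact: measurable_dot_sub.
  under eq_fun do rewrite invfM.
  by apply: measurable_funM => //; exact: measurable_inv_enorm_exp.
elim: n => [|n [IH1 IH2]].
  by split=> //; exact: (mS 0%N (cst 0)).
split=> //; apply: (mS n.+1 (fun y => (n.+1%:R + 2) * cube_taylor x v n y)) => //.
exact: measurable_funM.
Qed.

(** The squared distance along the line is a quadratic in t with middle coefficient 2 v . (x - y),
    and |v . (x - y)| <= |x - y| by Cauchy-Schwarz. *)
Lemma analytic0_inv_enorm_cube x v y d : 0 < d -> d <= enorm (x - y) -> enorm v = 1 ->
  analytic0 (fun t => (enorm (x + t *: v - y) ^+ 3)^-1) (cube_taylor x v ^~ y)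
    (4 / d ^+ 3) (d / 8).
Proof.
move=> d0 dxy v1.
rewrite (_ : (fun t => _) = fun t => (Num.sqrt (enorm (x - y) ^+ 2 +
    2 * dot v (x - y) * t + t ^+ 2) ^+ 3)^-1); last first.
  apply/funext => t; rewrite -sqr_enorm_line// sqrtr_sqr ger0_norm ?enorm_ge0//.
  by rewrite addrAC.
apply: analytic0_inv_cube => //.
by rewrite (le_trans (cauchy_schwarz _ _))// v1 mul1r.
Qed.

Lemma cube_taylor1 x v y : cube_taylor x v 1 y =
  - 3 * dot v (x - y) * (enorm (x - y) ^+ 5)^-1.
Proof.
rewrite /cube_taylor/= addr0 mulr0 add0r mul1r.
by rewrite -!exprVn; ring.
Qed.

Lemma cube_taylor2 x v y : enorm (x - y) != 0 -> cube_taylor x v 2 y =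
  (15 * dot v (x - y) ^+ 2 / enorm (x - y) ^+ 2 - 3) / 2 * (enorm (x - y) ^+ 5)^-1.
Proof.
move=> e0; rewrite /cube_taylor/=.
by field.
Qed.

End newtonian_kernels.

Section standard_basis.
Context {R : realType}.
Implicit Types (x : 'rV[R]_3).

Lemma dot_delta (i : 'I_3) x : dot (delta_mx 0 i) x = x 0 i.
Proof.
rewrite /dot (bigD1 i)//= big1 => [|j ji].
  by rewrite mxE !eqxx mul1r addr0.
by rewrite mxE (negbTE ji) andbF mul0r.
Qed.

Lemma sum_delta_mul (i : 'I_3) (g : 'I_3 -> R) :
  \sum_j (delta_mx 0 j : 'rV[R]_3) 0 i * g j = g i.
Proof.
rewrite (bigD1 i)//= big1 => [|j ji].
  by rewrite mxE !eqxx mul1r addr0.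
by rewrite mxE eq_sym (negbTE ji) andbF mul0r.
Qed.

Lemma sum_sqr_coord x : \sum_(i < 3) x 0 i ^+ 2 = enorm x ^+ 2.
Proof. by rewrite sqr_enorm; apply: eq_bigr => i _; rewrite expr2. Qed.

(* The sum over the basis of the second Taylor coefficients is
   [1/2 Laplacian |x - y|^-3 = 3 |x - y|^-5]. *)
Lemma sum_cube_taylor2 x y : enorm (x - y) != 0 ->
  \sum_(i < 3) cube_taylor x (delta_mx 0 i) 2%N y = 3 * (enorm (x - y) ^+ 5)^-1.
Proof.
move=> e0; under eq_bigr do rewrite cube_taylor2// dot_delta.
rewrite -mulr_suml -mulr_suml big_split/= sumr_const card_ord.
rewrite -mulr_suml -mulr_sumr sum_sqr_coord mulfK ?expf_neq0//.
by congr (_ * _); rewrite -mulr_natr; field.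
Qed.

End standard_basis.

(** * Harmonicity of dipole and Poisson integrals off their sources *)

Section kernel_harmonicity.
Context {R : realType} (mu : {measure set 'rV[R]_3 -> \bar R}).
Context (K : set 'rV[R]_3) (f : 'rV[R]_3 -> R) (x : 'rV[R]_3) (d M : R).
Hypotheses (mK : measurable K) (fi : mu.-integrable K (EFin \o f)).
Hypotheses (d0 : 0 < d) (Kx : forall y, K y -> d <= enorm (x - y) <= M).

Let C := 4 / d ^+ 3.
Let C0 : 0 <= C. Proof. by rewrite divr_ge0// exprn_ge0// ltW. Qed.
Let r0 : 0 < d / 8. Proof. by rewrite divr_gt0. Qed.

(** The kernel is the affine function (x - y)_i + t v_i times the inverse cube. In the Laplacian, 3
    (x - y)_i |x - y|^-5 from the second coefficients cancels against the first coefficient along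
    the i-th basis vector. *)
Lemma dipole_kernel_harmonic (i : 'I_3) :
  harmonic_at (fun x => \int[mu]_(y in K) (f y * ((x - y) 0 i / enorm (x - y) ^+ 3)))
    x (d / 8).
Proof.
apply: (@integral_mul_harmonic _ _ _ mu K f mK fi _ (fun v n y =>
  (x - y) 0 i * cube_taylor x v n y + v 0 i * shift_seq (cube_taylor x v ^~ y) n)
  (M * C + C * (d / 8))) => //.
- move=> z; apply: measurable_funTS; apply: measurable_funM.
    exact: measurable_sub_coord.
  exact: measurable_inv_enorm_exp.
- move=> v n; apply: measurable_funTS; apply: measurable_funD.
    by apply: measurable_funM; [exact: measurable_sub_coord|exact: measurable_cube_taylor].
  apply: measurable_funM => //; case: n => [|n] //=.
  exact: measurable_cube_taylor.
- move=> v y v1 Ky; have /andP[dxy xyM] := Kx Ky.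
  have g := analytic0_inv_enorm_cube d0 dxy v1.
  rewrite (_ : (fun t : R => _) = fun t => (x - y) 0 i * (enorm (x + t *: v - y) ^+ 3)^-1 +
      v 0 i * (t * (enorm (x + t *: v - y) ^+ 3)^-1)); last first.
    by apply/funext => t; rewrite !mxE; ring.
  apply: analytic0_le r0 (lexx _) _ (analytic0D (analytic0Z _ g)
    (analytic0Z _ (analytic0X r0 g))).
  rewrite lerD ?ler_wpM2r//.
    by rewrite (le_trans (enorm_coord _ _)).
  rewrite -[leRHS]mul1r ler_wpM2r//; first by rewrite mulr_ge0// ltW.
  by rewrite -v1 enorm_coord.
- move=> y Ky; have /andP[dxy _] := Kx Ky.
  have e0 : enorm (x - y) != 0 by rewrite gt_eqF// (lt_le_trans d0).
  rewrite big_split/= -mulr_sumr sum_cube_taylor2//.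
  by rewrite sum_delta_mul cube_taylor1 dot_delta; ring.
Qed.

(** Along a line the numerator is |x|^2 - rho^2 + 2 (v . x) t + t^2. The basis sum is 3 |x - y|^-5
    times |x|^2 - rho^2 - 2 x . (x - y) + |x - y|^2, which vanishes because |y| = rho. *)
Lemma poisson_kernel_harmonic (rho : R) : (forall y, K y -> enorm y = rho) ->
  harmonic_at (fun x => \int[mu]_(y in K)
    (f y * ((enorm x ^+ 2 - rho ^+ 2) / enorm (x - y) ^+ 3))) x (d / 8).
Proof.
move=> Krho.
apply: (@integral_mul_harmonic _ _ _ mu K f mK fi _ (fun v n y =>
  (enorm x ^+ 2 - rho ^+ 2) * cube_taylor x v n y +
  (2 * dot v x * shift_seq (cube_taylor x v ^~ y) n +
   shift_seq (shift_seq (cube_taylor x v ^~ y)) n))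
  (`|enorm x ^+ 2 - rho ^+ 2| * C +
    (2 * enorm x * (C * (d / 8)) + C * (d / 8) * (d / 8)))) => //.
- move=> z; apply: measurable_funTS; apply: measurable_funM => //.
  exact: measurable_inv_enorm_exp.
- move=> v n; apply: measurable_funTS; apply: measurable_funD.
    by apply: measurable_funM => //; exact: measurable_cube_taylor.
  apply: measurable_funD.
    apply: measurable_funM => //; case: n => [|n] //=.
    exact: measurable_cube_taylor.
  by case: n => [|[|n]] //=; exact: measurable_cube_taylor.
- move=> v y v1 Ky; have /andP[dxy xyM] := Kx Ky.
  have g := analytic0_inv_enorm_cube d0 dxy v1.
  rewrite (_ : (fun t : R => _) = fun t =>
      (enorm x ^+ 2 - rho ^+ 2) * (enorm (x + t *: v - y) ^+ 3)^-1 +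
      (2 * dot v x * (t * (enorm (x + t *: v - y) ^+ 3)^-1) +
       t * (t * (enorm (x + t *: v - y) ^+ 3)^-1))); last first.
    by apply/funext => t; rewrite sqr_enorm_line//; ring.
  apply: analytic0_le r0 (lexx _) _ (analytic0D (analytic0Z _ g) (analytic0D
    (analytic0Z _ (analytic0X r0 g)) (analytic0X r0 (analytic0X r0 g)))).
  rewrite lerD2l lerD2r ler_wpM2r//; first by rewrite mulr_ge0// ltW.
  rewrite normrM ger0_norm// ler_wpM2l//.
  by rewrite (le_trans (cauchy_schwarz _ _))// v1 mul1r.
- move=> y Ky; have /andP[dxy _] := Kx Ky.
  have e0 : enorm (x - y) != 0 by rewrite gt_eqF// (lt_le_trans d0).
  rewrite big_split/= -mulr_sumr sum_cube_taylor2// big_split/=.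
  have -> : \sum_(i < 3) 2 * dot (delta_mx 0 i) x * cube_taylor x (delta_mx 0 i) 1 y =
      - 6 * dot x (x - y) / enorm (x - y) ^+ 5.
    rewrite /(dot x) mulr_sumr mulr_suml; apply: eq_bigr => i _.
    by rewrite cube_taylor1 !dot_delta; ring.
  rewrite sumr_const card_ord -(Krho y Ky).
  have -> : (enorm (x - y) ^+ 3)^-1 = enorm (x - y) ^+ 2 / enorm (x - y) ^+ 5 :> R by field.
  rewrite !sqr_enorm !dot_lin (dotC y x) -mulr_natr; ring.
Qed.

End kernel_harmonicity.

(** * The potentials of the sphere *)

Section decay.
Context {R : realType}.
Implicit Types (F G : 'rV[R]_3 -> R) (k : R).

Lemma vanishes_at_infinityD F G : vanishes_at_infinity F -> vanishes_at_infinity G ->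
  vanishes_at_infinity (fun x => F x + G x).
Proof.
move=> Foo Goo e e0; have e20 : 0 < e / 2 by rewrite divr_gt0.
have [L FL] := Foo _ e20; have [L' GL'] := Goo _ e20.
exists (Num.max L L') => x; rewrite ge_max => /andP[/FL Fx /GL' Gx].
by rewrite (le_trans (ler_normD _ _))// (splitr e) lerD.
Qed.

Lemma vanishes_at_infinityZ k F : vanishes_at_infinity F ->
  vanishes_at_infinity (fun x => k * F x).
Proof.
move=> Foo e e0; have k1 : 0 < `|k| + 1 by rewrite ltr_wpDl.
have [L FL] := Foo _ (divr_gt0 e0 k1); exists L => x /FL Fx.
rewrite normrM (le_trans (ler_wpM2l (normr_ge0 _) Fx))//.
by rewrite mulrCA ger_pMr// ler_pdivrMr// mul1r lerDl.
Qed.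

Lemma vanishes_at_infinity_kernel d (T : measurableType d)
    (mu : {measure set T -> \bar R}) (K : set T) (f : T -> R)
    (k : 'rV[R]_3 -> T -> R) (A rho : R) :
  measurable K -> mu.-integrable K (EFin \o f) -> (forall x, measurable_fun K (k x)) ->
  (forall x y, rho + 1 <= enorm x -> K y -> `|k x y| <= A / (enorm x - rho)) ->
  vanishes_at_infinity (fun x => \int[mu]_(y in K) (f y * k x y)).
Proof.
move=> mK fi mk kA e e0; set I := \int[mu]_(y in K) `|f y|.
exists (Num.max (rho + 1) (rho + `|A * I| / e)) => x.
rewrite ge_max => /andP[x1 x2]; have s0 : 0 < enorm x - rho by lra.
apply: (le_trans (le_normr_integral_mul mK fi (mk x) (fun y => kA x y x1))).
rewrite -/I mulrAC ler_pdivrMr// (le_trans (ler_norm _))//.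
by rewrite -ler_pdivrMl// [_^-1 * _]mulrC; lra.
Qed.

End decay.

Section sphere_potentials.
Context {R : realType}.
Implicit Types (x y : 'rV[R]_3) (r d : R) (G : set 'rV[R]_3).

(** Finite total mass makes square integrable densities integrable, the form in which they enter the
    estimates. *)
Lemma sphere_measure_fin r : sphere_measure r [set: 'rV[R]_3] \is a fin_num.
Proof.
rewrite ge0_fin_numE; last exact: measure_ge0.
rewrite /sphere_measure preimage_setT setIT.
have mD := @measurable_sphere_dom R.
have dom_fin : ((lebesgue_measure \x lebesgue_measure) (@sphere_dom R) < +oo)%E.
  rewrite /sphere_dom product_measure1E//= !lebesgue_measure_itv/=.
  by do 2 case: ifP => _; rewrite -?EFinB ?mule0 ?mul0e -?EFinM ?ltry.
have : (lebesgue_measure \x lebesgue_measure)%E.-integrable (@sphere_dom R)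
    (EFin \o (fun p : measurableTypeR R * measurableTypeR R => r ^+ 2 * sin p.1)).
  apply: measurable_bounded_integrable => //.
  - apply/measurable_EFinP; exact: measurable_sphere_density.
  - exists (r ^+ 2); split; first exact: num_real.
    move=> M rM p _ /=; rewrite normrM ger0_norm ?sqr_ge0//.
    rewrite (le_trans _ (ltW rM))// ler_piMr ?sqr_ge0//.
    by rewrite ler_norml sin_geN1 sin_le1.
move=> /integrableP[mf]; apply: le_lt_trans; apply: ge0_le_integral => //.
- by move=> p; exact: sphere_density_ge0.
- exact: measurableT_comp.
- by move=> p _; exact: lee_abs.
Qed.

Lemma measurable_closed G : closed G -> measurable G.
Proof.
move=> cG; rewrite -(setCK G); apply: measurableC; apply: sub_sigma_algebra.
exact: closed_openC.
Qed.

Lemma measurable_esphere r : measurable (esphere r : set 'rV[R]_3).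
Proof.
have := @measurable_enorm_sub R 0 measurableT [set r] (measurable_set1 r).
rewrite setTI; congr measurable; apply/seteqP; split=> y /=;
  by rewrite sub0r enormN.
Qed.

Lemma L2_integrable r G h : measurable G -> L2 r G h ->
  (sphere_measure r).-integrable G (EFin \o h).
Proof.
move=> mG /(Lfun_subset12 (sphere_measure_fin r))/Lfun1_integrable hi.
apply/integrable_mkcond => //; apply: eq_integrable hi => // y _ /=.
by rewrite /patch; case: ifP.
Qed.

End sphere_potentials.

Section dipole_potential.
Context {R : realType} (R0 : R) (G : set 'rV[R]_3) (m : 'rV[R]_3 -> 'rV[R]_3).
Hypotheses (cG : closed G) (Gsub : G `<=` esphere R0) (hm : L2_vec R0 G m).
Implicit Types (x y : 'rV[R]_3) (d : R).

Let mG : measurable G. Proof. exact: measurable_closed. Qed.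
Let mi i : (sphere_measure R0).-integrable G (EFin \o (fun y => m y 0 i)).
Proof. exact: L2_integrable. Qed.

Let I (i : 'I_3) x := \int[sphere_measure R0]_(y in G)
  (m y 0 i * ((x - y) 0 i / enorm (x - y) ^+ 3)).

Let dist_le x y : G y -> enorm (x - y) <= enorm x + R0.
Proof. by move=> /Gsub yR; rewrite (le_trans (enormD _ _))// enormN yR. Qed.

(** Splitting the integral of the scalar product needs each term integrable, which the positive
    distance to [G] provides. *)
Lemma Phi0_sum d x : 0 < d -> (forall y, G y -> d <= enorm (x - y)) ->
  Phi0 R0 G m x = (4 * pi)^-1 * (I 0 x + I 1 x + I 2 x).
Proof.
move=> d0 dG; congr (_ * _).
have ii i : (sphere_measure R0).-integrable G
    (EFin \o (fun y => m y 0 i * ((x - y) 0 i / enorm (x - y) ^+ 3))).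
  apply: (@integrable_mul_bounded _ _ _ _ _ _ mG (mi i) _ ((enorm x + R0) / d ^+ 3)).
    apply: measurable_funTS; apply: measurable_funM; first exact: measurable_sub_coord.
    exact: measurable_inv_enorm_exp.
  move=> y Gy; have dy := dG y Gy; have ey := lt_le_trans d0 dy.
  rewrite normrM normfV (ger0_norm (exprn_ge0 _ (enorm_ge0 _))).
  rewrite ler_pM ?invr_ge0 ?exprn_ge0 ?enorm_ge0//.
    by rewrite (le_trans (enorm_coord _ _))// dist_le.
  by rewrite lef_pV2 ?posrE ?exprn_gt0// lerXn2r ?nnegrE ?enorm_ge0// ltW.
have iij i j : (sphere_measure R0).-integrable G
    (EFin \o (fun y => m y 0 i * ((x - y) 0 i / enorm (x - y) ^+ 3) +
                       m y 0 j * ((x - y) 0 j / enorm (x - y) ^+ 3))).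
  have := integrableD mG (ii i) (ii j).
  by apply: eq_integrable => // y _; rewrite /= EFinD.
rewrite /I -!RintegralD//; apply: eq_Rintegral => y _.
by rewrite dotE; ring.
Qed.

Lemma Phi0_harmonic d x : 0 < d -> (forall y, G y -> d <= enorm (x - y)) ->
  harmonic_at (Phi0 R0 G m) x (d / 8).
Proof.
move=> d0 dG; have d80 : 0 < d / 8 by rewrite divr_gt0.
have Ii i : harmonic_at (I i) x (d / 8).
  apply: (@dipole_kernel_harmonic _ _ _ _ _ _ (enorm x + R0)) => // y Gy.
  by rewrite dG// dist_le.
apply: eq_harmonic_at d80 _ (harmonic_atZ (4 * pi)^-1
  (harmonic_atD (harmonic_atD (Ii 0) (Ii 1)) (Ii 2))) => z zx.
(* Within d / 8 of [x] the distance to [G] is still at least d / 2. *)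
rewrite (@Phi0_sum (d / 2))// ?divr_gt0// => y /dG dy.
have := enormD (x - z) (z - y); rewrite subrKA (enormBC x z); lra.
Qed.

Lemma Phi0_vanishes_at_infinity : vanishes_at_infinity (Phi0 R0 G m).
Proof.
have Ioo i : vanishes_at_infinity (I i).
  apply: (@vanishes_at_infinity_kernel _ _ _ _ _ _ _ 1 R0) => // [x|x y x1 Gy].
    apply: measurable_funTS; apply: measurable_funM; first exact: measurable_sub_coord.
    exact: measurable_inv_enorm_exp.
  have := enormB_ge x y; rewrite (Gsub Gy) => s.
  have s1 : 1 <= enorm x - R0 by lra.
  have e1 : 1 <= enorm (x - y) by lra.
  have e0 : 0 < enorm (x - y) by lra.
  rewrite normrM normfV (ger0_norm (exprn_ge0 _ (enorm_ge0 _))) ler_pdivrMr ?exprn_gt0//.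
  rewrite mulrAC mul1r ler_pdivlMr; last lra.
  (* The kernel is of order |x - y|^-2; since |x - y| >= 1, this is weakened to the rate 1 / (|x| -
     R0). *)
  apply: (@le_trans _ _ (enorm (x - y) * enorm (x - y))).
    by rewrite ler_pM ?enorm_coord//; lra.
  by rewrite [leRHS]exprS expr2 ler_peMl// mulr_ge0// ltW.
have := vanishes_at_infinityZ (4 * pi)^-1
  (vanishes_at_infinityD (vanishes_at_infinityD (Ioo 0) (Ioo 1)) (Ioo 2)).
move=> h e /h[L hL]; exists (Num.max L (R0 + 1)) => x.
rewrite ge_max => /andP[/hL Lx x1].
rewrite (@Phi0_sum 1)// => y Gy.
by have := enormB_ge x y; rewrite (Gsub Gy); lra.
Qed.

End dipole_potential.

Section poisson_potential.
Context {R : realType} (R1 : R) (h : 'rV[R]_3 -> R).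
Hypotheses (R10 : 0 < R1) (hh : L2 R1 (esphere R1) h).
Implicit Types (x y : 'rV[R]_3) (d : R).

Let mS : measurable (esphere R1 : set 'rV[R]_3). Proof. exact: measurable_esphere. Qed.
Let hi : (sphere_measure R1).-integrable (esphere R1) (EFin \o h).
Proof. exact: L2_integrable. Qed.

Lemma Phi1_harmonic d x : 0 < d -> (forall y, esphere R1 y -> d <= enorm (x - y)) ->
  harmonic_at (Phi1 R1 h) x (d / 8).
Proof.
move=> d0 dS; apply: harmonic_atZ.
apply: (@poisson_kernel_harmonic _ _ _ _ _ _ (enorm x + R1)) => // y Sy.
by rewrite dS// (le_trans (enormD _ _))// enormN Sy.
Qed.

Lemma Phi1_vanishes_at_infinity : vanishes_at_infinity (Phi1 R1 h).
Proof.
apply: vanishes_at_infinityZ.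
apply: (@vanishes_at_infinity_kernel _ _ _ _ _ _ _ (1 + 2 * R1) R1) => // [x|x y x1 Sy].
  by apply: measurable_funTS; apply: measurable_funM => //; exact: measurable_inv_enorm_exp.
have := enormB_ge x y; rewrite Sy; set s := enorm x - R1 => sxy.
have s1 : 1 <= s by rewrite /s; lra.
(* As |x - y| >= s, the kernel is at most (s + 2 R1) / s^2, which is at most (1 + 2 R1) / s for s >=
   1. *)
have -> : enorm x ^+ 2 - R1 ^+ 2 = s * (s + 2 * R1) by rewrite /s; ring.
clearbody s.
have s0 : 0 < s by lra.
have e0 : 0 < enorm (x - y) by lra.
have n0 : 0 <= s * (s + 2 * R1) 
  by rewrite mulr_ge0 ?(ltW s0)// addr_ge0 ?(ltW s0)// mulr_ge0// ltW.
rewrite normrM normfV (ger0_norm (exprn_ge0 _ (enorm_ge0 _))) ger0_norm//.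
apply: (@le_trans _ _ (s * (s + 2 * R1) / s ^+ 3)).
  by rewrite ler_wpM2l// lef_pV2 ?posrE ?exprn_gt0// lerXn2r ?nnegrE// ltW.
rewrite ler_pdivrMr ?exprn_gt0// mulrAC ler_pdivlMr//.
have : 0 <= R1 * (s - 1) by rewrite mulr_ge0 ?(ltW R10)// subr_ge0.
have : 0 <= s ^+ 2 by rewrite exprn_ge0// ltW.
nra.
Qed.

End poisson_potential.

(** * Uniqueness *)

Section sphere_paths.
Context {R : realType}.
Implicit Types (p q x : 'rV[R]_3) (a b t : R).

Lemma orthogonal_unit p : exists2 q : 'rV[R]_3, enorm q = 1 & dot p q = 0.
Proof.
pose w : 'rV[R]_3 := \row_j [:: - p 0 1; p 0 0; 0]`_j.
have [w0|w0] := eqVneq (enorm w) 0; last first.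
  exists ((enorm w)^-1 *: w).
    by rewrite enormZ normfV ger0_norm ?enorm_ge0// mulVf.
  by rewrite dot_lin [X in _ * X](_ : _ = 0) ?mulr0// dotE !mxE /=; ring.
(* Here [w] = 0, so [p] lies on the third axis. *)
exists (delta_mx 0 0); first exact: enorm_delta.
rewrite dotC dot_delta; apply/eqP; rewrite -normr_le0 -w0.
by have := enorm_coord w 1; rewrite mxE.
Qed.

(** Gram-Schmidt: the component of [x] orthogonal to [p] has length sqrt (1 - (p . x)^2). When it is
    zero, any unit vector orthogonal to [p] serves, which covers x = p and x = - p. *)
Lemma unit_decomposition p x : enorm p = 1 -> enorm x = 1 ->
  exists2 q : 'rV[R]_3, enorm q = 1 /\ dot p q = 0 &
    x = dot p x *: p + Num.sqrt (1 - dot p x ^+ 2) *: q.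
Proof.
move=> p1 x1; set c := dot p x; pose v := x - c *: p.
have pp : dot p p = 1 by rewrite -sqr_enorm p1 expr1n.
have xx : dot x x = 1 by rewrite -sqr_enorm x1 expr1n.
have pv : dot p v = 0 by rewrite /v !dot_lin pp -/c; ring.
have vE : enorm v = Num.sqrt (1 - c ^+ 2).
  by rewrite /enorm; congr Num.sqrt; rewrite /v !dot_lin pp xx (dotC x p) -/c; ring.
have xE : x = c *: p + v by rewrite addrC subrK.
have [v0|v0] := eqVneq (enorm v) 0.
  have [q q1 pq] := orthogonal_unit p; exists q => //.
  rewrite -vE v0 scale0r addr0 {1}xE; apply/eqP.
  by rewrite -subr_eq0 addrC addKr -normr_le0 -v0 norm_le_enorm.
exists ((enorm v)^-1 *: v); last by rewrite -vE scalerA divff// scale1r.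
by rewrite enormZ normfV ger0_norm ?enorm_ge0// mulVf// dotZr pv mulr0.
Qed.

Lemma abs_sin_le t : `|sin t| <= `|t|.
Proof.
have [s _] := @mean_value_at0 R sin cos t (fun s _ => is_derive_sin s).
rewrite sin0 subr0 => ->; rewrite normrM ler_piMl//.
by rewrite ler_norml cos_geN1 cos_le1.
Qed.

(** The squared chord is 2 - 2 cos (a - b) = 4 sin^2 ((a - b) / 2), and |sin t| <= |t|. *)
Lemma circle_lipschitz p q a b : enorm p = 1 -> enorm q = 1 -> dot p q = 0 ->
  enorm (cos a *: p + sin a *: q - (cos b *: p + sin b *: q)) <= `|a - b|.
Proof.
move=> p1 q1 pq.
have pp : dot p p = 1 by rewrite -sqr_enorm p1 expr1n.
have qq : dot q q = 1 by rewrite -sqr_enorm q1 expr1n.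
rewrite -(@ler_pXn2r _ 2%N) ?nnegrE ?enorm_ge0// sqr_enorm !dot_lin.
rewrite pp qq (dotC q p) pq.
have h : cos (a - b) = 1 - 2 * sin ((a - b) / 2) ^+ 2.
  rewrite {1}(splitr (a - b)) cosD -!expr2; have := cos2Dsin2 ((a - b) / 2); lra.
have ca := cos2Dsin2 a; have cb := cos2Dsin2 b.
have s2 : sin ((a - b) / 2) ^+ 2 <= (`|a - b| / 2) ^+ 2.
  rewrite -real_normK ?num_real// lerXn2r ?nnegrE//.
  by rewrite (le_trans (abs_sin_le _))// normrM normfV (@ger0_norm _ 2).
move: h; rewrite cosB => h; move: s2; rewrite expr_div_n; lra.
Qed.

Lemma sphere_path (rho : R) x y : 0 < rho -> enorm x = rho -> enorm y = rho ->
  exists2 g : R -> 'rV[R]_3, g 0 = x /\ g 1 = y &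
  exists2 L : R, (forall s t : R, enorm (g s - g t) <= L * `|s - t|) &
    forall s, enorm (g s) = rho.
Proof.
move=> rho0 xr yr.
have u z : enorm z = rho -> enorm (rho^-1 *: z) = 1.
  by move=> zr; rewrite enormZ zr gtr0_norm ?invr_gt0// mulVf// gt_eqF.
have [q [q1 pq]] := unit_decomposition (u _ xr) (u _ yr).
set p := rho^-1 *: x in pq *; set c := dot p _ => yE.
have p1 : enorm p = 1 by exact: u.
have xE : rho *: p = x by rewrite scalerA divff ?scale1r// gt_eqF.
clearbody p.
have pp : dot p p = 1 by rewrite -sqr_enorm p1 expr1n.
have qq : dot q q = 1 by rewrite -sqr_enorm q1 expr1n.
have c1 : -1 <= c <= 1.
  have := cauchy_schwarz p (rho^-1 *: y); rewrite p1 u// mulr1 ler_norml.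
  by [].
(* The great circle arc from x to y, run at constant speed through the angle [acos c]. *)
exists (fun s => rho *: (cos (s * acos c) *: p + sin (s * acos c) *: q)).
  split.
    by rewrite mul0r cos0 sin0 scale0r addr0 scale1r.
  rewrite mul1r acosK ?in_itv//= sin_acos// -yE.
  by rewrite scalerA divff ?scale1r// gt_eqF.
exists (rho * `|acos c|) => [s t|s].
  rewrite -scalerBr enormZ gtr0_norm// -mulrA ler_pM2l//.
  by rewrite (le_trans (circle_lipschitz _ _ p1 q1 pq))// -mulrBl normrM mulrC.
rewrite enormZ gtr0_norm// (_ : enorm _ = 1) ?mulr1//.
rewrite /enorm !dot_lin pp qq (dotC q p) pq !mulr0 add0r addr0 !mulr1 -!expr2.
by rewrite cos2Dsin2 sqrtr1.
Qed.

End sphere_paths.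

(** * Uniqueness outside a sphere, gluing across a sphere, distances along a ray *)

Section separation.
Context {R : realType}.
Implicit Types (F G : 'rV[R]_3 -> R) (x y : 'rV[R]_3) (r d e rho : R).

Lemma harmonic_at_near F G x r e : 0 < r -> 0 < e -> harmonic_at F x r ->
  (forall y, enorm (y - x) < e -> F y = G y) ->
  exists2 r' : R, 0 < r' & harmonic_at G x r'.
Proof.
move=> r0 e0 Fx FG; have e20 : 0 < e / 2 by rewrite divr_gt0.
have m0 : 0 < Num.min r (e / 2) by rewrite lt_min r0.
exists (Num.min r (e / 2)) => //.
apply: (@eq_harmonic_at _ F) => // [y yx|].
  apply: FG; apply: (le_lt_trans yx).
  by rewrite gt_min ltr_pdivrMr// ltr_pMr// ltr1n orbT.
by apply: harmonic_at_le Fx => //; rewrite ge_min lexx.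
Qed.

(** Extension by zero to |x| < rho is continuous because [F] vanishes on the sphere, and it is
    harmonic wherever it is nonzero, so the maximum principle applies to it. *)
Lemma exterior_uniqueness F rho :
  (forall x, rho <= enorm x -> exists2 r, 0 < r & harmonic_at F x r) ->
  vanishes_at_infinity F -> (forall x, enorm x = rho -> F x = 0) ->
  forall x, rho <= enorm x -> F x = 0.
Proof.
move=> Fh Foo F0 x xrho.
pose G y := if rho <= enorm y then F y else 0.
suff : G x = 0 by rewrite /G xrho.
apply: harmonic_eq0.
- move=> z e e0; have [zr|rz] := ltP (enorm z) rho.
    exists (rho - enorm z); first by rewrite subr_gt0.
    move=> y yz; have yr : enorm y < rho by have := enormB_ge y z; lra.
    by rewrite /G !leNgt zr yr/= subrr normr0.
  have [r r0 Fz] := Fh z rz.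
  have [d d0 Fd] := harmonic_at_continuous r0 Fz e0.
  move: rz; rewrite le_eqVlt => /predU1P[zr|rz].
    exists d => // y /Fd; rewrite /G -zr lexx (F0 z)//.
    by case: ifP; rewrite // subrr normr0.
  exists (Num.min d (enorm z - rho)); first by rewrite lt_min d0 subr_gt0.
  move=> y; rewrite lt_min => /andP[/Fd Fy yz].
  rewrite /G (ltW rz) ifT//.
  by have := enormB_ge z y; rewrite enormBC; lra.
- move=> z; rewrite /G; case: ifP => // rz Fz0.
  have rz' : rho < enorm z.
    by rewrite lt_neqAle rz andbT; apply/eqP => zr; apply: Fz0; exact: F0.
  have [r r0 Fz] := Fh z rz.
  apply: (@harmonic_at_near F _ z r (enorm z - rho)) => //; first by rewrite subr_gt0.
  move=> y yz; rewrite ifT//.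
  by have := enormB_ge z y; rewrite enormBC; lra.
- move=> e e0; have [L FL] := Foo e e0; exists L => y /FL.
  by rewrite /G; case: ifP => // _ _; rewrite normr0 ltW.
Qed.

Lemma glued_harmonic_eq0 F G rho :
  (forall x, enorm x <= rho -> exists2 r, 0 < r & harmonic_at F x r) ->
  (forall x, rho <= enorm x -> exists2 r, 0 < r & harmonic_at G x r) ->
  vanishes_at_infinity G ->
  (forall x, enorm x = rho -> vanishes_near (fun y => F y - G y) x) ->
  forall x, rho <= enorm x -> G x = 0.
Proof.
move=> Fh Gh Goo FG.
pose u y := if enorm y <= rho then F y else G y.
have uh x : exists2 r, 0 < r & harmonic_at u x r.
  have [xr|rx|xr] := ltgtP (enorm x) rho.
  - have [r r0 Fx] := Fh x (ltW xr).
    apply: (@harmonic_at_near F _ x r (rho - enorm x)) => //; first by rewrite subr_gt0.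
    by move=> y yx; rewrite /u ifT//; have := enormB_ge y x; lra.
  - have [r r0 Gx] := Gh x (ltW rx).
    apply: (@harmonic_at_near G _ x r (enorm x - rho)) => //; first by rewrite subr_gt0.
    move=> y yx; rewrite /u ifF//; apply/negbTE; rewrite -ltNge.
    by have := enormB_ge x y; rewrite enormBC; lra.
  (* On the interface both branches agree in a whole ball, so [u] coincides there with [F]. *)
  - have [r r0 Fx] : exists2 r, 0 < r & harmonic_at F x r by apply: Fh; rewrite xr.
    have [e e0 FGe] := FG x xr.
    apply: (@harmonic_at_near F _ x r e) => // y /FGe/eqP.
    by rewrite subr_eq0 /u => /eqP ->; case: ifP.
have u0 x : u x = 0.
  apply: harmonic_eq0 => {x} [x e e0|x _|e e0]; last 2 first.
  - exact: uh.
  - have [L GL] := Goo e e0; exists (Num.max L (rho + 1)) => x.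
    rewrite ge_max => /andP[/GL Gx x1]; rewrite /u ifF//.
    by apply/negbTE; rewrite -ltNge; lra.
  - by have [r r0 ux] := uh x; exact: harmonic_at_continuous ux e e0.
move=> x; rewrite le_eqVlt => /predU1P[xr|rx]; last first.
  by rewrite -(u0 x) /u leNgt rx.
have [e e0 /(_ x)] := FG x (esym xr); rewrite subrr enorm0 => /(_ e0)/eqP.
by rewrite subr_eq0 => /eqP <-; rewrite -(u0 x) /u -xr lexx.
Qed.

Lemma closed_dist_gt0 (A : set 'rV[R]_3) x : closed A -> ~ A x ->
  exists2 e : R, 0 < e & forall y, A y -> e <= enorm (x - y).
Proof.
move=> cA Ax; have /nbhs_ballP[e /= e0 eA] : nbhs x (~` A).
  by apply: open_nbhs_nbhs; split => //; exact: closed_openC.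
exists e => // y Ay; rewrite leNgt; apply/negP => xy; apply: (eA y) => //.
by rewrite -ball_normE/=; apply: le_lt_trans xy; exact: norm_le_enorm.
Qed.

(* The squared distance from [c x] to [y] is
   [(c - 1)^2 rho^2 + c |x - y|^2] when [|x| = |y| = rho]. *)
Lemma dist_ray (rho c c0 e : R) x y : enorm x = rho -> enorm y = rho ->
  0 < c0 <= 1 -> c0 <= c -> 0 <= e <= enorm (x - y) -> c0 * e <= enorm (c *: x - y).
Proof.
move=> xr yr /andP[c00 c01] c0c /andP[e0 exy].
rewrite -(@ler_pXn2r _ 2%N) ?nnegrE ?enorm_ge0 ?mulr_ge0 ?(ltW c00)//.
have -> : enorm (c *: x - y) ^+ 2 = (c - 1) ^+ 2 * rho ^+ 2 + c * enorm (x - y) ^+ 2.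
  have xx : dot x x = rho ^+ 2 by rewrite -sqr_enorm xr.
  have yy : dot y y = rho ^+ 2 by rewrite -sqr_enorm yr.
  by rewrite !sqr_enorm !dot_lin xx yy (dotC y x); ring.
apply: (@le_trans _ _ (c * enorm (x - y) ^+ 2)).
  rewrite exprMn ler_pM ?exprn_ge0 ?(ltW c00)//; last by rewrite lerXn2r ?nnegrE ?enorm_ge0.
  by rewrite (le_trans _ c0c)// expr2 ler_piMr// ltW.
by rewrite lerDr mulr_ge0// sqr_ge0.
Qed.

End separation.

(** * Separation of two harmonic functions with sources on different spheres *)

Section unique_separation.
Context {R : realType} (R1 R0 R2 : R) (Gamma : set 'rV[R]_3) (u0 u1 : 'rV[R]_3 -> R).
Hypotheses (hR1 : 0 < R1) (hR10 : R1 < R0) (hR02 : R0 < R2).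
Hypotheses (Gamma_closed : closed Gamma) (Gamma_sub : Gamma `<=` esphere R0).
Hypothesis Gamma_neq : Gamma <> esphere R0.
Hypothesis hu0 : forall (d : R) x, 0 < d -> (forall y, Gamma y -> d <= enorm (x - y)) ->
  harmonic_at u0 x (d / 8).
Hypothesis hu1 : forall (d : R) x, 0 < d ->
  (forall y, esphere R1 y -> d <= enorm (x - y)) -> harmonic_at u1 x (d / 8).
Hypotheses (u0oo : vanishes_at_infinity u0) (u1oo : vanishes_at_infinity u1).
Hypothesis sum0 : forall x, esphere R2 x -> u0 x + u1 x = 0.

Let F x := u0 x + u1 x.
Let s := (R0 + R1) / 2.

Let hu1_norm (d : R) x : 0 < d -> R1 + d <= enorm x -> harmonic_at u1 x (d / 8).
Proof.
move=> d0 xd; apply: hu1 => // y yR1.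
by have := enormB_ge x y; rewrite yR1; lra.
Qed.

Let exterior x : R2 <= enorm x -> F x = 0.
Proof.
have [r1 r10 r02] : [/\ 0 < R1, R1 < R0 & R0 < R2] by [].
apply: exterior_uniqueness => {x} [x xR2| |x xR2].
- have d0 : 0 < (R2 - R0) / 8 by rewrite divr_gt0// subr_gt0.
  exists ((R2 - R0) / 8) => //; apply: harmonic_atD.
    apply: hu0 => [|y /Gamma_sub yR0]; first by rewrite subr_gt0.
    by have := enormB_ge x y; rewrite yR0; lra.
  by apply: hu1_norm; lra.
- exact: vanishes_at_infinityD.
- exact: sum0.
Qed.

Let sphere_near x : enorm x = s -> vanishes_near F x.
Proof.
have [r1 r10 r02] : [/\ 0 < R1, R1 < R0 & R0 < R2] by [].
move=> xs; have [x0 x0R0 Gx0] : exists2 x0, esphere R0 x0 & ~ Gamma x0.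
  apply/not_exists2P => h; apply: Gamma_neq; apply/seteqP; split=> // y yR0.
  by have [/(_ yR0)|/contrapT] := h y.
have [e e0 eG] := closed_dist_gt0 Gamma_closed Gx0.
have R00 : 0 < R0 by lra.
have s0 : 0 < s by rewrite /s; lra.
have [sR1 sR0] : R1 < s /\ s < R0 by rewrite /s; lra.
have hole : vanishes_near F ((s / R0) *: x0).
  (* The ray is run inwards, from radius [R2 + 1], where a unit ball lies in the exterior region, to
     radius [s]. *)
  pose c0 := s / R0; pose b := (R2 + 1) / R0.
  have c00 : 0 < c0 by rewrite divr_gt0.
  have c01 : c0 <= 1 by rewrite ler_pdivrMr// mul1r ltW.
  have cb : c0 <= b by rewrite ler_pM2r ?invr_gt0//; lra.
  have c0R : c0 * R0 = s by rewrite divfK// gt_eqF.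
  have bR : b * R0 = R2 + 1 by rewrite divfK// gt_eqF.
  pose g (t : R) := (b + t * (c0 - b)) *: x0.
  rewrite (_ : _ *: x0 = g 1); last by rewrite /g mul1r addrC subrK.
  (* On the ray |x| >= s, so the inner sphere is at distance at least s - R1; [dist_ray] keeps
     [Gamma] at distance at least c0 * e even where the ray crosses radius [R0]. *)
  pose d := Num.min (s - R1) (c0 * e).
  have d0 : 0 < d by rewrite lt_min subr_gt0 sR1 mulr_gt0.
  clearbody c0 b.
  apply: (@vanishes_along_path _ F g (`|c0 - b| * R0) (d / 8)).
  - by rewrite divr_gt0.
  - move=> t t'; rewrite -scalerBl enormZ x0R0 opprD addrACA subrr add0r -mulrBl.
    by rewrite normrM -mulrA mulrC.
  - move=> t /andP[t0 t1].
    have ct : c0 <= b + t * (c0 - b).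
      rewrite -subr_ge0 (_ : _ - _ = (1 - t) * (b - c0)); last by ring.
      by rewrite mulr_ge0// subr_ge0.
    have nt : s <= enorm (g t).
      rewrite enormZ x0R0 ger0_norm; last exact: le_trans (ltW c00) ct.
      by rewrite -c0R ler_pM2r.
    apply: harmonic_atD.
      apply: hu0 => // y Gy; apply: (@le_trans _ _ (c0 * e)).
        by rewrite ge_min lexx orbT.
      apply: (@dist_ray _ R0) => //; first exact: Gamma_sub.
        by rewrite c00.
      by rewrite (ltW e0) eG.
    apply: hu1_norm => //; apply: le_trans nt.
    by rewrite -lerBrDl ge_min lexx.
  - exists 1 => // y; rewrite {1}/g mul0r addr0 => yb; apply: exterior.
    have := enormB_ge (b *: x0) y.
    rewrite enormBC enormZ x0R0 ger0_norm ?bR; last exact: le_trans (ltW c00) cb.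
    lra.
have x0s : enorm ((s / R0) *: x0) = s.
  rewrite enormZ x0R0 ger0_norm; last by apply: divr_ge0; exact: ltW.
  by rewrite divfK// gt_eqF.
have [g [g0 g1] [L gL gs]] := sphere_path s0 x0s xs.
rewrite -g1; rewrite -g0 in hole.
(* The sphere of radius [s] is midway, at this distance from both source spheres. *)
have d0 : 0 < (R0 - R1) / 2 by lra.
apply: (@vanishes_along_path _ F g L ((R0 - R1) / 2 / 8)) => //; first by lra.
move=> t _; apply: harmonic_atD.
  apply: hu0 => // y /Gamma_sub yR0.
  by have := enormB_ge y (g t); rewrite enormBC yR0 gs /s; lra.
by apply: hu1_norm => //; rewrite gs /s; lra.
Qed.

Lemma separated_potentials_eq0 x : esphere R2 x -> u0 x = 0 /\ u1 x = 0.
Proof.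
have [r1 r10 r02] : [/\ 0 < R1, R1 < R0 & R0 < R2] by [].
move=> xR2; suff u1x : - 1 * u1 x = 0.
  have : u1 x = 0 by lra.
  by move=> u1x0; have := sum0 xR2; rewrite u1x0 addr0.
have [sR1 sR0] : R1 < s /\ s < R0 by rewrite /s; lra.
(* The gluing gives u1 = 0 on all of |x| >= s, hence at radius [R2]; [sum0] has already turned this
   into u0 = 0. *)
apply: (@glued_harmonic_eq0 _ u0 (fun y => - 1 * u1 y) s) => [z zs|z zs||z zs|].
- have d0 : 0 < R0 - s by rewrite subr_gt0.
  exists ((R0 - s) / 8); first by rewrite divr_gt0.
  apply: hu0 => // y /Gamma_sub yR0.
  by have := enormB_ge y z; rewrite enormBC yR0; lra.
- have d0 : 0 < s - R1 by rewrite subr_gt0.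
  exists ((s - R1) / 8); first by rewrite divr_gt0.
  by apply: harmonic_atZ; apply: hu1_norm => //; lra.
- exact: vanishes_at_infinityZ.
- have [e e0 Fe] := sphere_near zs; exists e => // y /Fe.
  by rewrite mulN1r opprK.
- by rewrite xR2; lra.
Qed.

End unique_separation.

Theorem corollary4p4 (R : realType) (R1 R0 R2 : R) (Gamma : set 'rV[R]_3)
  (hR1 : 0 < R1) (hR10 : R1 < R0) (hR02 : R0 < R2)
  (Gamma_closed : closed Gamma) (Gamma_sub : Gamma `<=` esphere R0)
  (Gamma_neq : Gamma <> esphere R0)
  (Phi : 'rV[R]_3 -> R)
  (m : 'rV[R]_3 -> 'rV[R]_3) (h : 'rV[R]_3 -> R)
  (hm : L2_vec R0 Gamma m) (hh : L2 R1 (esphere R1) h)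
  (hPhi : forall x, esphere R2 x -> Phi x = Phi0 R0 Gamma m x + Phi1 R1 h x)
  (m' m'' : 'rV[R]_3 -> 'rV[R]_3) (h' h'' : 'rV[R]_3 -> R)
  (hm' : L2_vec R0 Gamma m') (hh' : L2 R1 (esphere R1) h')
  (hm'' : L2_vec R0 Gamma m'') (hh'' : L2 R1 (esphere R1) h'')
  (hPhi' : forall x, esphere R2 x ->
     Phi x = Phi0 R0 Gamma m' x + Phi1 R1 h' x)
  (hPhi'' : forall x, esphere R2 x ->
     Phi x = Phi0 R0 Gamma m'' x + Phi1 R1 h'' x) :
  forall x, esphere R2 x ->
    Phi0 R0 Gamma m' x = Phi0 R0 Gamma m'' x /\
    Phi1 R1 h' x = Phi1 R1 h'' x.
Proof.
move=> x xR2.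
(* Differences of the potentials are taken, not potentials of differences of densities: harmonicity
   and decay pass to linear combinations directly. *)
have [] := @separated_potentials_eq0 R R1 R0 R2 Gamma
  (fun y => Phi0 R0 Gamma m' y + - 1 * Phi0 R0 Gamma m'' y)
  (fun y => Phi1 R1 h' y + - 1 * Phi1 R1 h'' y)
  hR1 hR10 hR02 Gamma_closed Gamma_sub Gamma_neq _ _ _ _ _ x xR2; last by lra.
- move=> d y d0 dG.
  by apply: harmonic_atD; [|apply: harmonic_atZ]; exact: Phi0_harmonic.
- move=> d y d0 dS.
  by apply: harmonic_atD; [|apply: harmonic_atZ]; exact: Phi1_harmonic.
- by apply: vanishes_at_infinityD; [|apply: vanishes_at_infinityZ];
    exact: Phi0_vanishes_at_infinity.
- by apply: vanishes_at_infinityD; [|apply: vanishes_at_infinityZ];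
    exact: Phi1_vanishes_at_infinity.
- by move=> y yR2; have := hPhi' y yR2; have := hPhi'' y yR2; lra.
Qed.
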